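(* For each integer $n\ge2$ let $m_n$ be an integer with $1\le m_n\le n-1$, and assume $m_n=o(n)$ as $n\to\infty$. Put $\delta_n=-\log\left(1-\frac{m_n}{n}\right)$ and, for each fixed $c\in\mathbb{R}$, $$k_n(c)=\left\lfloor\frac{\log n+c}{\delta_n}\right\rfloor .$$ Then for each fixed $c\in\mathbb{R}$, $$\lambda_n=n\left(1-\frac{m_n}{n}\right)^{k_n(c)}\longrightarrow e^{-c},\qquad n-m_n\longrightarrow\infty .$$ Consequently, for every fixed integer $p\ge1$ and every fixed $c\in\mathbb{R}$, $$\left\lVert (Q_{n,p}^{(m_n)})^{*k_n(c)}-U_{n,p}\right\rVert_{\mathrm{TV}}\longrightarrow f_p(c),$$ and $$\mathrm{sep}\!\left((Q_{n,p}^{(m_n)})^{*k_n(c)},U_{n,p}\right)\longrightarrow\begin{cases}1-e^{-e^{-c}}(1+e^{-c}),&p=1,\\ 1-e^{-e^{-c}},&p\ge2.\end{cases}$$ In particular the total variation cutoff location is $\frac{\log n}{\delta_n}\sim\frac{n}{m_n}\log n$, with window $\frac1{\delta_n}\sim\frac{n}{m_n}$.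
   Context: $G_{n,p}=C_p\wr S_n\cong C_p^n\rtimes S_n$ is the group of $p$-colored permutations, thought of as arrangements of a deck of $n$ cards labelled $1,\dots,n$, each card carrying a color in $C_p=\mathbb{Z}/p\mathbb{Z}$; the identity is the deck in order $1,2,\dots,n$ from top to bottom with all colors $0$. $U_{n,p}$ is the uniform distribution on $G_{n,p}$. One step of the $p$-colored top-$m$-to-random shuffle ($1\le m\le n$): remove the top $m$ cards, recolor those $m$ cards by independent uniform elements of $C_p$, apply a uniform random permutation to the removed block, choose an $m$-element set of final positions uniformly among all $\binom nm$ possibilities, and insert the removed cards into those positions; the remaining $n-m$ cards preserve their relative order and color. $Q_{n,p}^{(m)}$ is the one-step law on $G_{n,p}$, and $(Q_{n,p}^{(m)})^{*k}$ is its $k$-fold convolution power, i.e. the law of the deck after $k$ independent steps started from the identity. For fixed $c$, $k_n(c)\ge0$ for all sufficiently large $n$, which is all that matters for the limits. $\lVert M-U\rVert_{\mathrm{TV}}=\frac12\sum_x|M(x)-U(x)|$ and $\mathrm{sep}(M,U)=\max_x\left(1-\frac{M(x)}{U(x)}\right)$. With $y_+=\max(y,0)$, $$f_p(c)=\sum_{\ell=0}^\infty a_{\ell,p}\bigl(s_{\ell,p}(e^{-c})-1\bigr)_+,\qquad a_{\ell,p}=\frac1{\ell!\,p^\ell}-\frac1{(\ell+1)!\,p^{\ell+1}},\qquad s_{\ell,p}(\lambda)=e^{-\lambda}\sum_{u=0}^{\ell}(p\lambda)^u .$$ Total variation cutoff at location $t_n$ with window $w_n$ has the standard meaning: writing $d_n(k)=\lVert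 (Q_{n,p}^{(m_n)})^{*k}-U_{n,p}\rVert_{\mathrm{TV}}$, one has $w_n=o(t_n)$, $\lim_{c\to-\infty}\liminf_{n\to\infty} d_n(\lfloor t_n+cw_n\rfloor)=1$ and $\lim_{c\to+\infty}\limsup_{n\to\infty} d_n(\lfloor t_n+cw_n\rfloor)=0$. Here $x_n\sim y_n$ means $x_n/y_n\to1$. *)

(* Defs.v *)
From HB Require Import structures.
From mathcomp Require Import all_boot all_order all_algebra all_fingroup.
From mathcomp Require Import all_classical all_reals all_analysis.
Set Implicit Arguments.
Unset Strict Implicit.
Unset Printing Implicit Defensive.
Import Order.TTheory GRing.Theory Num.Theory.
Import numFieldNormedType.Exports.
Local Open Scope ring_scope.

(* C_p as an additive cyclic group, for p >= 1.  'I_p.-1.+1 is used instead of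
   'Z_p because 'Z_1 has two elements. *)
Notation color p := ('I_p.-1.+1).

(* The group G_{n,p} = C_p wr S_n.  Its elements are arrangements of the deck:
   card i (cards and positions are numbered from 0, position 0 is the top) lies
   at position card_pos i and has color card_color i. *)
Record colored_perm (n p : nat) := ColoredPerm {
  card_pos : {perm 'I_n};
  card_color : {ffun 'I_n -> color p} }.

Section ColoredPermFinite.
Variables n p : nat.
Local Notation G := (colored_perm n p).

Definition pair_of_colored_perm (x : G) := (card_pos x, card_color x).
Definition colored_perm_of_pair (u : {perm 'I_n} * {ffun 'I_n -> color p}) : G :=
  ColoredPerm u.1 u.2.

Lemma pair_of_colored_permK : cancel pair_of_colored_perm colored_perm_of_pair.
Proof. by case. Qed.

End ColoredPermFinite.

HB.instance Definition _ (n p : nat) :=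
  Finite.copy (colored_perm n p) (can_type (@pair_of_colored_permK n p)).

Section ColoredPermGroup.
Variables n p : nat.
Local Notation G := (colored_perm n p).

(* x * y is the deck obtained from the deck x by the rearrangement that turns
   the identity deck into y: y moves positions, and the color which y gives to
   "card" j is added to the color of the card at position j of x. *)
Definition colored_perm_mul (x y : G) : G :=
  ColoredPerm (card_pos x * card_pos y)%g
    [ffun i => card_color x i + card_color y (card_pos x i)].

Definition colored_perm_one : G := ColoredPerm 1%g [ffun=> 0].

Definition colored_perm_inv (x : G) : G :=
  ColoredPerm (card_pos x)^-1%g [ffun i => - card_color x ((card_pos x)^-1%g i)].

Lemma colored_perm_mulA : associative colored_perm_mul.
Proof.
move=> x y z; congr ColoredPerm => /=; first by rewrite mulgA.
by apply/ffunP => i; rewrite !ffunE permM addrA.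
Qed.

Lemma colored_perm_mul1 : left_id colored_perm_one colored_perm_mul.
Proof.
case=> s c; congr ColoredPerm => /=; first by rewrite mul1g.
by apply/ffunP => i; rewrite !ffunE perm1 add0r.
Qed.

Lemma colored_perm_mulV :
  left_inverse colored_perm_one colored_perm_inv colored_perm_mul.
Proof.
case=> s c; congr ColoredPerm => /=; first by rewrite mulVg.
by apply/ffunP => i; rewrite !ffunE addNr.
Qed.

End ColoredPermGroup.

HB.instance Definition _ (n p : nat) :=
  Finite_isGroup.Build (colored_perm n p)
    (@colored_perm_mulA n p) (@colored_perm_mul1 n p) (@colored_perm_mulV n p).

Section Shuffle.
Variable n : nat.

(* enum lists a set of positions in increasing order, so insert_pos A k is the
   final position of the k-th card when the first #|A| cards are put, in order,
   into the positions of A, and the others, in order, into the remaining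
   positions.  The default value k of nth is never used. *)
Definition insert_pos (A : {set 'I_n}) (k : 'I_n) : 'I_n :=
  nth k (enum A ++ enum (~: A)) k.

Lemma insert_pos_inj (A : {set 'I_n}) : injective (insert_pos A).
Proof.
have sz : size (enum A ++ enum (~: A)) = n.
  by rewrite size_cat -!cardE cardsC card_ord.
have un : uniq (enum A ++ enum (~: A)).
  rewrite cat_uniq !enum_uniq /= andbT; apply/hasPn => x.
  by rewrite !mem_enum inE.
move=> k l; rewrite /insert_pos (set_nth_default k l) ?sz //.
by move/eqP; rewrite nth_uniq ?sz // => /eqP /val_inj.
Qed.

Definition insert_perm (A : {set 'I_n}) : {perm 'I_n} :=
  perm (@insert_pos_inj A).

(* The random choices made in one step: a permutation of the top m cards, new
   colors for the top m cards, and an m-element set of final positions. *)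
Definition shuffle_choices (p m : nat) :
    {set {perm 'I_n} * {ffun 'I_n -> color p} * {set 'I_n}} :=
  [set w : {perm 'I_n} * {ffun 'I_n -> color p} * {set 'I_n} |
           [&& perm_on [set i : 'I_n | (i < m)%N] w.1.1,
               [forall i : 'I_n, (m <= i)%N ==> (w.1.2 i == 0)] &
               #|w.2| == m]].

(* The deck obtained from the identity deck. *)
Definition shuffle_result (p : nat)
    (w : {perm 'I_n} * {ffun 'I_n -> color p} * {set 'I_n}) : colored_perm n p :=
  ColoredPerm (w.1.1 * insert_perm w.2)%g w.1.2.

End Shuffle.

(* Q_{n,p}^(m): the image of the uniform law on the choices. *)
Definition shuffle_law (R : realType) (n p m : nat) : colored_perm n p -> R :=
  fun x => #|[set w in shuffle_choices n p m | shuffle_result w == x]|%:R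
           / #|shuffle_choices n p m|%:R.

Section Laws.
Variables (R : realType) (gT : finGroupType).
Implicit Types M N : gT -> R.

Definition uniform_law : gT -> R := fun _ => #|gT|%:R^-1.

Definition convolution M N : gT -> R := fun x => \sum_(y : gT) M y * N (y^-1 * x)%g.

Fixpoint convolution_pow M (k : nat) : gT -> R :=
  if k is k'.+1 then convolution (convolution_pow M k') M else fun x => (x == 1%g)%:R.

Definition tv_dist M N : R := 2^-1 * \sum_(x : gT) `|M x - N x|.

(* The initial value of the maximum is the term of the identity, so that this
   is exactly the maximum over the group. *)
Definition sep_dist M N : R :=
  \big[Num.max/(1 - M 1%g / N 1%g)]_(x : gT) (1 - M x / N x).

End Laws.

Arguments uniform_law : clear implicits.

Local Open Scope classical_set_scope.

Section Limits.
Variable R : realType.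

Definition shuffle_tv (m : nat -> nat) (p n k : nat) : R :=
  tv_dist (convolution_pow (@shuffle_law R n p (m n)) k)
          (uniform_law R (colored_perm n p)).

Definition shuffle_sep (m : nat -> nat) (p n k : nat) : R :=
  sep_dist (convolution_pow (@shuffle_law R n p (m n)) k)
           (uniform_law R (colored_perm n p)).

Definition delta (m : nat -> nat) (n : nat) : R :=
  - ln (1 - (m n)%:R / n%:R).

(* Num.truncn is the floor on nonnegative reals and 0 on negative ones. *)
Definition steps (m : nat -> nat) (c : R) (n : nat) : nat :=
  Num.truncn ((ln n%:R + c) / delta m n).

Definition a_coef (p l : nat) : R :=
  ((l`! * p ^ l)%N%:R)^-1 - ((l.+1`! * p ^ l.+1)%N%:R)^-1.

Definition s_coef (p l : nat) (lambda : R) : R :=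
  expR (- lambda) * \sum_(0 <= u < l.+1) (p%:R * lambda) ^+ u.

Definition tv_profile (p : nat) (c : R) : R :=
  limn (series (fun l => a_coef p l * Num.max (s_coef p l (expR (- c)) - 1) 0)).

Definition asymp_equiv (x y : nat -> R) : Prop :=
  (fun n => x n / y n) @ \oo --> (1 : R).

(* d n k is the total variation distance after k steps for the n-th chain.  The
   lower and upper limits are taken in the extended reals. *)
Definition tv_cutoff (d : nat -> nat -> R) (t w : nat -> R) : Prop :=
  [/\ (fun n => w n / t n) @ \oo --> (0 : R),
      (fun c : R => limn_einf (fun n => (d n (Num.truncn (t n + c * w n)))%:E))
        @ -oo --> 1%:E &
      (fun c : R => limn_esup (fun n => (d n (Num.truncn (t n + c * w n)))%:E))
        @ +oo --> 0%:E].

End Limits.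

(* Main.v *)
Require Import Defs.
From HB Require Import structures.
From mathcomp Require Import all_boot all_order all_algebra all_fingroup.
From mathcomp Require Import all_classical all_reals all_analysis.
From mathcomp Require Import zify ring lra.
Set Implicit Arguments.
Unset Strict Implicit.
Unset Printing Implicit Defensive.
Import Order.TTheory GRing.Theory Num.Theory.
Import numFieldNormedType.Exports.
Local Open Scope classical_set_scope.
Local Open Scope ring_scope.

(** The shuffle is governed by the cards that have never been removed from the
    top.  The cards leave the untouched part of the deck in the order of their
    labels, so after k steps the untouched cards are the last Z of them; they
    still have color 0 and still follow each other in increasing order, while
    the touched cards are placed and colored uniformly at random.  Call
    [tail_len x] the length L(x) of the longest final segment of labels whose
    cards have color 0 and increasing positions in the deck x.  Then the law
    after k steps has, with respect to the uniform law, the density g(L(x)) with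
       g(l) = sum over z <= l of P(Z = z) z! p^z           ([density]),
    and a uniform deck satisfies L >= l with probability 1 / (l! p^l), hence
    L = l with probability [a_coef p l] for l < n.  This turns both distances
    into explicit expressions in the numbers g(l) ([shuffle_tv_density],
    [shuffle_sep_density]).

    The number Z is the number of coupons still missing after k draws of random
    sets of m coupons among n.  Its binomial moments are
    E C(Z, r) = C(n, r) (C(n - r, m) / C(n, m))^k; they converge to
    lambda^r / r! with lambda = exp (- c), so Z tends to a Poisson variable of
    parameter lambda ([cvg_untouched_prob]) and g(l) tends to [s_coef p l lambda].
    The separation distance is 1 minus the least value of g, and the total
    variation distance converges term by term, because
    the levels L >= M contribute at most 1 / (M! p^M) to it, uniformly in n.

    The mixture formula for the law after k steps is derived algebraically, not
    by following Z.  Let X_j be the indicator of the decks in which the cards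
    from j on may all be untouched ([tail_ind]), multiplied by convolution.  Looking at
    the last insertion of the top card gives X_j X_1 = p j X_j + X_(j+1)
    ([convolution_tail_ind1]), so that X_j = X_1 (X_1 - p) ... (X_1 - p (j - 1)).
    All X_j are hence polynomials in X_1 and p^-j X_j corresponds to the falling
    factorial t^_j with t = X_1 / p.  The one-step law is X_m normalized
    ([shuffle_lawE]), its k-th power corresponds to the function
    t |-> (C(t, m) / C(n, m))^k, and the expansion of this function in falling
    factorials is Newton's interpolation formula: the weights P(Z = z) are its
    finite differences at 0 ([convolution_pow_shuffle_law]). *)

(** * Decks in which the last cards are untouched *)

Section TailSorted.
Variables n p : nat.
Local Notation G := (colored_perm n p).
Implicit Types x y : G.

(** The decks that can arise when only the cards before j have been touched. *)
Definition tail_sorted (j : nat) (x : G) : bool :=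
  [forall i : 'I_n, (j <= i)%N ==> (card_color x i == 0)] &&
  [forall i : 'I_n, forall i' : 'I_n,
     (j <= i < i')%N ==> (card_pos x i < card_pos x i')%N].

Lemma tail_sortedP j x :
  reflect ((forall i : 'I_n, (j <= i)%N -> card_color x i = 0) /\
           (forall i i' : 'I_n, (j <= i < i')%N -> (card_pos x i < card_pos x i')%N))
          (tail_sorted j x).
Proof.
apply: (iffP andP) => -[hc hp]; split.
- by move=> i ji; move/forallP: hc => /(_ i); rewrite ji => /eqP.
- by move=> i i' ii'; move/forallP: hp => /(_ i) /forallP /(_ i'); rewrite ii'.
- by apply/forallP => i; apply/implyP => ji; rewrite hc.
- by apply/forallP => i; apply/forallP => i'; apply/implyP => ii'; apply: hp.
Qed.

Lemma colored_permP x y :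
  card_pos x = card_pos y -> card_color x = card_color y -> x = y.
Proof. by case: x y => s c [s' c'] /= -> ->. Qed.

Lemma tail_sortedW j j' x : (j <= j')%N -> tail_sorted j x -> tail_sorted j' x.
Proof.
move=> jj' /tail_sortedP [hc hp]; apply/tail_sortedP; split.
  by move=> i /(leq_trans jj'); apply: hc.
by move=> i i' /andP [/(leq_trans jj') ji ii']; apply: hp; rewrite ji.
Qed.

Lemma tail_sorted_full x : tail_sorted n x.
Proof.
apply/tail_sortedP; split=> [i|i i' /andP [+ _]]; rewrite leqNgt ltn_ord //.
Qed.

(** An increasing self-map of a final segment of 'I_n moves no element down, by
    induction from below, and none up, by induction from above. *)
Lemma perm_sorted_tail_fix (j : nat) (s : {perm 'I_n}) :
  (forall i i' : 'I_n, (j <= i < i')%N -> (s i < s i')%N) ->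
  (forall i : 'I_n, (j <= i)%N -> (j <= s i)%N) ->
  forall i : 'I_n, (j <= i)%N -> s i = i.
Proof.
move=> mono stab.
have ge (i : 'I_n) : (j <= i)%N -> (i <= s i)%N.
  have [k] := ubnP (i : nat); elim: k i => // k IH i; rewrite ltnS => ik.
  rewrite leq_eqVlt => /predU1P [e|ji]; first by rewrite -[X in (X <= _)%N]e stab // e.
  have i1n : (i.-1 < n)%N by apply: leq_ltn_trans (leq_pred _) (ltn_ord i).
  pose i1 := Ordinal i1n.
  have ji1 : (j <= i1)%N by rewrite /= -ltnS prednK // (leq_ltn_trans _ ji).
  have /IH/(_ ji1) h : (i1 < k)%N by rewrite /= prednK // (leq_ltn_trans _ ji).
  have /mono : (j <= i1 < i)%N by rewrite ji1 /= prednK // (leq_ltn_trans _ ji).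
  rewrite /= in h *; lia.
have le (i : 'I_n) : (j <= i)%N -> (s i <= i)%N.
  have [k] := ubnP (n - i)%N; elim: k i => // k IH i; rewrite ltnS => ik ji.
  have [i1n|] := ltnP i.+1 n; last first.
    by move=> ni; rewrite -ltnS; apply: leq_trans ni.
  pose i1 := Ordinal i1n.
  have h : (s i1 <= i1)%N by apply: IH => /=; [lia | exact: leqW].
  have /mono : (j <= i < i1)%N by rewrite ji /=.
  rewrite /= in h *; lia.
by move=> i ji; apply/val_inj/eqP; rewrite eqn_leq le ?ge.
Qed.

(** The positions not taken by the cards before j can be filled in only one
    increasing way. *)
Lemma tail_sorted_inj j x y : tail_sorted j x -> tail_sorted j y ->
  (forall i : 'I_n, (i < j)%N -> card_pos x i = card_pos y i) ->
  (forall i : 'I_n, (i < j)%N -> card_color x i = card_color y i) -> x = y.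
Proof.
move=> /tail_sortedP [xc xp] /tail_sortedP [yc yp] epos ecol.
apply: colored_permP; last first.
  by apply/ffunP => i; have [/ecol //|ji] := ltnP i j; rewrite xc ?yc.
(* t matches the cards of x with the cards of y at the same positions. *)
pose t := (card_pos x * (card_pos y)^-1)%g.
have tlt (i : 'I_n) : (i < j)%N -> t i = i by move=> ij; rewrite permM epos // permK.
have tge (i : 'I_n) : (j <= i)%N -> (j <= t i)%N.
  move=> ji; rewrite leqNgt; apply/negP => h.
  have /perm_inj e := tlt _ h; by move: h; rewrite e ltnNge ji.
have tP (i : 'I_n) : card_pos y (t i) = card_pos x i by rewrite permM permKV.
have tmono (i i' : 'I_n) : (j <= i < i')%N -> (t i < t i')%N.
  move=> /[dup] /andP [ji ii'] /xp; rewrite -!tP ltnNge leq_eqVlt negb_or => h.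
  rewrite ltnNge leq_eqVlt negb_or; apply/andP; split.
    by apply/eqP => /val_inj e; move: h; rewrite e eqxx.
  apply/negP => lt; case/andP: h => _ /negP; apply; apply: yp.
  by rewrite lt andbT tge // (leq_trans ji (ltnW ii')).
apply/permP => i; rewrite -tP; congr (card_pos y _).
by have [/tlt //|ji] := ltnP i j; apply: (@perm_sorted_tail_fix j).
Qed.

Lemma tail_sorted0 x : tail_sorted 0 x = (x == 1%g).
Proof.
have t1 : tail_sorted 0 (1%g : G).
  by apply/tail_sortedP; split=> [i _|i i' /= ii']; rewrite ?ffunE ?perm1.
by apply/idP/eqP => [tx|->//]; apply: (@tail_sorted_inj 0).
Qed.

Lemma card_colored_perm : (0 < p)%N -> #|{: G}| = (p ^ n * n`!)%N.
Proof.
move=> p0; rewrite (bij_eq_card (f := @pair_of_colored_perm n p)); last first.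
  exists (@colored_perm_of_pair n p); first exact: pair_of_colored_permK.
  by case.
by rewrite card_prod card_ffun !card_ord prednK // card_Sn mulnC.
Qed.

End TailSorted.

(** * Convolution on a finite group *)

Section Convolution.
Variables (R : realType) (gT : finGroupType).
Implicit Types M N P : gT -> R.

(** The last factor as the summation variable: the deck before the last move w was
    x w^-1. *)
Lemma convolutionE M N x : convolution M N x = \sum_(w : gT) N w * M (x * w^-1)%g.
Proof.
rewrite /convolution (reindex_inj (h := fun w => x * w^-1)%g).
  by apply: eq_bigr => w _; rewrite invMg invgK -mulgA mulVg mulg1 mulrC.
by move=> u v /mulgI /invg_inj.
Qed.

Lemma convolutionA M N P :
  convolution M (convolution N P) = convolution (convolution M N) P.
Proof.
apply/funext => x; rewrite !convolutionE.
under eq_bigr do rewrite convolutionE mulr_suml.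
rewrite exchange_big /=; apply: eq_bigr => v _.
rewrite convolutionE mulr_sumr (reindex_inj (mulIg v)); apply: eq_bigr => w _ /=.
by rewrite mulgK invMg mulgA mulrA.
Qed.

Lemma convolution_suml (I : Type) (r : seq I) (a : I -> R) (M : I -> gT -> R) N x :
  convolution (fun x => \sum_(i <- r) a i * M i x) N x =
  \sum_(i <- r) a i * convolution (M i) N x.
Proof.
rewrite /convolution; under eq_bigr do rewrite mulr_suml.
rewrite exchange_big /=; apply: eq_bigr => i _.
by rewrite mulr_sumr; apply: eq_bigr => y _; rewrite mulrA.
Qed.

Lemma sum_convolution M N :
  \sum_x convolution M N x = (\sum_x M x) * (\sum_x N x).
Proof.
rewrite /convolution exchange_big mulr_suml; apply: eq_bigr => y _ /=.
rewrite -mulr_sumr (reindex_inj (mulgI y)) /=; congr (_ * _).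
by apply: eq_bigr => x _; rewrite mulKg.
Qed.

Lemma convolution_pow_ge0 M k x : (forall y, 0 <= M y) -> 0 <= convolution_pow M k x.
Proof.
move=> M0; elim: k x => [|k IH] x /=; first exact: ler0n.
by apply: sumr_ge0 => y _; apply: mulr_ge0.
Qed.

Lemma sum_convolution_pow M k : \sum_x M x = 1 -> \sum_x convolution_pow M k x = 1.
Proof.
move=> M1; elim: k => [|k IH] /=; last by rewrite sum_convolution IH M1 mulr1.
by rewrite (bigD1 1%g) //= eqxx big1 ?addr0 // => y /negPf ->.
Qed.

End Convolution.

(** * The top-to-random recursion *)

Definition tail_ind (R : realType) (n p j : nat) (x : colored_perm n p) : R :=
  (tail_sorted j x)%:R.

Section TopToRandom.
Variables (n' p : nat).
Local Notation n := n'.+1.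
Local Notation G := (colored_perm n p).

(** The decks of [tail_sorted 1], parametrized by the position and the color of the
    card which was on top ([sum_tail_ind1]). *)
Definition top_insertion (q : 'I_n) (c : color p) : G :=
  ColoredPerm (lift_perm ord0 q 1) [ffun i => if i == ord0 then c else 0].

Lemma top_insertion_tail_sorted q c : tail_sorted 1 (top_insertion q c).
Proof.
apply/tail_sortedP; split=> [i i0|i i'] /=.
  by rewrite ffunE; case: eqP i0 => // ->.
case: (unliftP ord0 i) => [k ->|-> //]; case: (unliftP ord0 i') => [k' ->|-> //].
by rewrite !lift_perm_lift !perm1 /= /bump !leq0n; case: leqP; case: leqP; lia.
Qed.

Lemma sum_tail_ind1 (R : realType) (F : G -> R) :
  \sum_y tail_ind R 1 y * F y = \sum_q \sum_c F (top_insertion q c).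
Proof.
rewrite pair_bigA /= (eq_bigr (fun y => if tail_sorted 1 y then F y else 0)).
  rewrite -big_mkcond /=.
  rewrite (reindex_onto (fun u : 'I_n * color p => top_insertion u.1 u.2)
             (fun y => (card_pos y ord0, card_color y ord0))) /=.
    apply: eq_bigl => -[q c] /=.
    by rewrite top_insertion_tail_sorted lift_perm_id ffunE /= eqxx.
  move=> y ty; apply: tail_sorted_inj (top_insertion_tail_sorted _ _) ty _ _ => i;
    rewrite ltnS leqn0 => /eqP i0; have -> : i = ord0 by apply: val_inj.
  - by rewrite /= lift_perm_id.
  - by rewrite /= ffunE.
by move=> y _; rewrite /tail_ind; case: tail_sorted; rewrite ?mul1r ?mul0r.
Qed.

Section MoveToTop.
Variables (x : G) (i0 : 'I_n) (c : color p).

(** The deck from which x is obtained by taking off the top card i0, changing its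
    color by c, and inserting it at the place that it has in x. *)
Definition move_to_top : G := (x * (top_insertion (card_pos x i0) c)^-1)%g.

Lemma move_to_top_pos : card_pos move_to_top i0 = ord0.
Proof. by rewrite /= permM lift_permV lift_perm_id. Qed.

Lemma move_to_top_pos_gt0 i : i != i0 -> (0 < card_pos move_to_top i)%N.
Proof.
rewrite lt0n; apply: contra => /eqP h; apply/eqP.
by apply: (@perm_inj _ (card_pos move_to_top)); rewrite move_to_top_pos; apply: val_inj.
Qed.

Lemma move_to_top_lt i i' : i != i0 -> i' != i0 ->
  (card_pos move_to_top i < card_pos move_to_top i')%N =
  (card_pos x i < card_pos x i')%N.
Proof.
rewrite -(inj_eq (@perm_inj _ (card_pos x)) i) -(inj_eq (@perm_inj _ (card_pos x)) i').
rewrite /= !permM !lift_permV.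
case: (unliftP (card_pos x i0) (card_pos x i)) => [k ->|->]; last by rewrite eqxx.
case: (unliftP (card_pos x i0) (card_pos x i')) => [k' ->|->]; last by rewrite eqxx.
move=> _ _; rewrite !lift_perm_lift invg1 !perm1 /= /bump !leq0n.
case: (leqP (card_pos x i0) k); case: (leqP (card_pos x i0) k') => /=;
  rewrite ?add0n ?add1n ?ltnS.
all: lia.
Qed.

Lemma move_to_top_color i :
  card_color move_to_top i = card_color x i - (if i == i0 then c else 0).
Proof.
rewrite /= ffunE /= ffunE ffunE; congr (_ - _).
rewrite -permM -[(card_pos x * _)%g]/(card_pos move_to_top).
case: eqP => [h|h]; case: eqP => [e|e] //.
- apply: contra_notP e => _; apply: (@perm_inj _ (card_pos move_to_top)).
  by rewrite h move_to_top_pos.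
- by case: h; rewrite e move_to_top_pos.
Qed.

(** Moving a card before j to the top does not disturb the cards from j on.  The
    card j itself becomes the first of the cards from j on, so in x only the later
    ones have to be in order, and its color must be reset to 0.  A later card
    cannot be above j. *)
Lemma tail_sorted_move_to_top j : tail_sorted j move_to_top =
  if (i0 < j)%N then tail_sorted j x else
  if i0 == j :> nat then tail_sorted j.+1 x && (c == card_color x i0) else false.
Proof.
have [ij|ji] := ltnP i0 j.
  have ne (i : 'I_n) : (j <= i)%N -> i != i0.
    by apply: contraTneq => ->; rewrite -ltnNge.
  apply/tail_sortedP/tail_sortedP => -[hc hp]; split.
  - by move=> i ji; rewrite -(hc i ji) move_to_top_color (negPf (ne _ ji)) subr0.
  - move=> i i' /[dup] /andP [ji ii'] /hp; rewrite move_to_top_lt ?ne //.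
    exact: leq_trans ji (ltnW ii').
  - by move=> i ji; rewrite -(hc i ji) move_to_top_color (negPf (ne _ ji)) subr0.
  - move=> i i' /[dup] /andP [ji ii'] /hp; rewrite -move_to_top_lt ?ne //.
    exact: leq_trans ji (ltnW ii').
case: eqP => [e|/eqP ne].
  have ne (i : 'I_n) : (j < i)%N -> i != i0.
    by apply: contraTneq => ->; rewrite -leqNgt e.
  apply/tail_sortedP/andP => [[hc hp]|[/tail_sortedP [hc hp] /eqP hcol]].
    split; last first.
      by have := hc i0; rewrite move_to_top_color eqxx => /(_ ji) /subr0_eq ->.
    apply/tail_sortedP; split.
    - move=> i ji'; rewrite -(hc i (ltnW ji')).
      by rewrite move_to_top_color (negPf (ne _ ji')) subr0.
    - move=> i i' /andP [ji' ii']; rewrite -move_to_top_lt ?ne ?hp ?ii' ?(ltnW ji') //.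
      exact: ltn_trans ji' ii'.
  split.
  - move=> i; rewrite move_to_top_color -e leq_eqVlt => /predU1P [/val_inj <-|].
      by rewrite eqxx hcol subrr.
    by rewrite e => ji'; rewrite (negPf (ne _ ji')) hc ?subr0.
  - move=> i i'; rewrite -{1}e => /andP []; rewrite leq_eqVlt => /predU1P [/val_inj <-|].
      by move=> ii'; rewrite move_to_top_pos move_to_top_pos_gt0 // ne // -e.
    rewrite e => ji' ii'; rewrite move_to_top_lt ?ne ?hp ?ji' //.
    exact: ltn_trans ji' ii'.
apply/negP => /tail_sortedP [_ hp].
have ltj : (j < i0)%N by rewrite ltn_neqAle eq_sym ne.
have := hp (Ordinal (ltn_trans ltj (ltn_ord i0))) i0.
by rewrite move_to_top_pos /= leqnn ltj => /(_ isT).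
Qed.

End MoveToTop.

(** The p j moves of a card before j are undone without effect on the order of the
    tail; among the moves of card j, exactly one restores its color. *)
Lemma convolution_tail_ind1 (R : realType) j (x : G) : (0 < p)%N -> (j <= n)%N ->
  convolution (tail_ind R j) (tail_ind R 1) x =
  (p * j)%:R * tail_ind R j x + (j < n)%:R * tail_ind R j.+1 x.
Proof.
move=> p0 jn; rewrite convolutionE sum_tail_ind1.
rewrite (reindex_inj (@perm_inj _ (card_pos x))) /=.
transitivity (\sum_(i0 : 'I_n) ((i0 < j)%:R * (p%:R * tail_ind R j x)
                + (i0 == j :> nat)%:R * tail_ind R j.+1 x)).
  apply: eq_bigr => i0 _.
  under eq_bigr do rewrite -[(x * _)%g]/(move_to_top x i0 _) /tail_ind
    tail_sorted_move_to_top.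
  case: ltnP => [ij|ji].
    rewrite (ltn_eqF ij) mul0r addr0 mul1r sumr_const card_ord prednK //.
    by rewrite mulr_natl.
  rewrite mul0r add0r; case: eqP => _; last by rewrite mul0r big1.
  rewrite mul1r (bigD1 (card_color x i0)) //= eqxx andbT big1 ?addr0 // => c ne.
  by rewrite (negPf ne) andbF.
have sum_lt : \sum_(i < n) (i < j)%:R = j%:R :> R.
  rewrite -[in RHS](card_ord j) -sum1_card natr_sum -(big_ord_narrow jn (F := fun=> 1)).
  by rewrite [RHS]big_mkcond; apply: eq_bigr => i _; case: ltnP.
have sum_eq : \sum_(i < n) (i == j :> nat)%:R = (j < n)%:R :> R.
  case: (ltnP j n) => [jn'|nj]; last first.
    by rewrite big1 // => i _; rewrite ltn_eqF ?(leq_trans (ltn_ord i)).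
  rewrite (bigD1 (Ordinal jn')) //= eqxx big1 ?addr0 // => i.
  by rewrite -val_eqE /= => /negPf ->.
by rewrite big_split /= -!mulr_suml sum_lt sum_eq natrM mulrA [j%:R * _]mulrC.
Qed.

End TopToRandom.

(** * The one-step law *)

Section OneStep.
Variables (n p m : nat).
Hypothesis m_le_n : (m <= n)%N.
Local Notation G := (colored_perm n p).

Section InsertPerm.
Variable A : {set 'I_n}.
Hypothesis cardA : #|A| = m.

Lemma insert_perm_in k : (insert_perm A k \in A) = (k < m)%N.
Proof.
rewrite permE /insert_pos nth_cat -cardE cardA; case: ltnP => km.
  by rewrite -mem_enum mem_nth // -cardE cardA.
apply/negbTE; rewrite -finset.in_setC -mem_enum mem_nth // -cardE.
have := cardsC A; rewrite cardA card_ord; have := ltn_ord k; lia.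
Qed.

Lemma insert_perm_lt (k k' : 'I_n) : (m <= k < k')%N ->
  (insert_perm A k < insert_perm A k')%N.
Proof.
move=> /andP [mk kk']; rewrite !permE /insert_pos !nth_cat -cardE cardA.
rewrite [(k < m)%N]ltnNge mk [(k' < m)%N]ltnNge (leq_trans mk (ltnW kk')) /=.
have sz : size (enum (~: A)) = (n - m)%N.
  by rewrite -cardE; have := cardsC A; rewrite cardA card_ord; lia.
have srt : sorted (fun a b : 'I_n => (a < b)%N) (enum (~: A)).
  rewrite {1}/enum_mem -enumT; apply: sorted_filter => [a b c|]; first exact: ltn_trans.
  have := iota_ltn_sorted 0 n; rewrite -val_enum_ord sorted_map.
  exact.
have ltk' : (k' - m < size (enum (~: A)))%N by rewrite sz; have := ltn_ord k'; lia.
rewrite (set_nth_default k) //.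
have ltk : (k - m < size (enum (~: A)))%N by lia.
apply: (sorted_ltn_nth (leT := fun a b : 'I_n => (a < b)%N) _ _ srt) => //.
  by move=> b a c; exact: ltn_trans.
lia.
Qed.

End InsertPerm.

(** Only the removed cards end up in the chosen set of positions, so this set can
    be read off from the resulting deck. *)
Lemma shuffle_result_in_set w i : w \in shuffle_choices n p m ->
  (card_pos (shuffle_result w) i \in w.2) = (i < m)%N.
Proof.
rewrite inE => /and3P [sP _ /eqP cA].
by rewrite /= permM insert_perm_in //; have := perm_closed i sP; rewrite !inE.
Qed.

Lemma shuffle_result_tail_sorted w : w \in shuffle_choices n p m ->
  tail_sorted m (shuffle_result w).
Proof.
rewrite inE => /and3P [sP /forallP cP /eqP cA]; apply/tail_sortedP; split=> /=.
  by move=> i mi; have := cP i; rewrite mi => /eqP.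
move=> i i' /andP [mi ii']; rewrite !permM !(out_perm sP) ?inE -?leqNgt //.
  by rewrite insert_perm_lt // mi.
exact: leq_trans mi (ltnW ii').
Qed.

Lemma shuffle_result_inj : {in shuffle_choices n p m &, injective (@shuffle_result n p)}.
Proof.
move=> w w' wP w'P e.
have eA : w.2 = w'.2.
  apply/setP => q; rewrite -(permKV (card_pos (shuffle_result w)) q).
  by rewrite shuffle_result_in_set // e shuffle_result_in_set.
case: w w' wP w'P e eA => [[s c] A] [[s' c'] A'] _ _ /= [+ ->] eA; rewrite eA.
by move/mulIg ->.
Qed.

(** The set of positions has to be that of the first m cards of x, and the
    permutation is then what is left after undoing the insertion; it fixes the
    other cards since it keeps their order. *)
Lemma shuffle_result_surj x : tail_sorted m x ->
  exists2 w, w \in shuffle_choices n p m & shuffle_result w = x.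
Proof.
move=> /tail_sortedP [xc xp].
pose A : {set 'I_n} := [set card_pos x i | i : 'I_n & (i < m)%N]%SET.
have cA : #|A| = m.
  rewrite card_imset; last exact: perm_inj.
  rewrite -sum1_card (eq_bigl (fun i : 'I_n => (i < m)%N)) => [|i]; last by rewrite inE.
  by rewrite (big_ord_narrow m_le_n) sum1_card card_ord.
have inA i : (card_pos x i \in A) = (i < m)%N.
  apply/imsetP/idP => [[i' i'm /perm_inj -> //]|im]; first by rewrite inE in i'm.
  by exists i; rewrite ?inE.
pose s := (card_pos x * (insert_perm A)^-1)%g.
have sE i : insert_perm A (s i) = card_pos x i by rewrite permM permKV.
have sm i : (s i < m)%N = (i < m)%N by rewrite -(insert_perm_in cA) sE inA.
have sfix : forall i : 'I_n, (m <= i)%N -> s i = i.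
  apply: perm_sorted_tail_fix => i; last by rewrite [(m <= i)%N]leqNgt [(m <= s i)%N]leqNgt sm.
  move=> i' /[dup] /andP [mi ii'] /xp; rewrite -(sE i) -(sE i'); apply: contraTT.
  rewrite -!leqNgt leq_eqVlt => /predU1P [/val_inj ->//|lt].
  rewrite ltnW // insert_perm_lt // lt andbT leqNgt sm -leqNgt.
  exact: leq_trans mi (ltnW ii').
exists (s, card_color x, A).
  rewrite inE cA eqxx andbT /=; apply/andP; split; last first.
    by apply/forallP => i; apply/implyP => mi; rewrite xc.
  apply/fintype.subsetP => i; rewrite !inE; apply: contraR.
  by rewrite -leqNgt => /sfix ->.
by apply: colored_permP => //=; rewrite mulgKV.
Qed.

Lemma card_shuffle_preimage x :
  #|[set w in shuffle_choices n p m | shuffle_result w == x]%SET| = tail_sorted m x.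
Proof.
case: (boolP (tail_sorted m x)) => tx.
  have [w wP <-] := shuffle_result_surj tx.
  rewrite (_ : [set _ in _ | _]%SET = [set w]%SET) ?cards1 //.
  apply/setP => w'; rewrite [LHS]inE finset.in_set1; apply/andP/eqP => [[w'P /eqP]|-> //].
  exact: shuffle_result_inj.
apply/eqP; rewrite cards_eq0; apply/eqP/setP => w; rewrite [LHS]inE finset.in_set0.
by apply: contraNF tx => /andP [wP /eqP <-]; exact: shuffle_result_tail_sorted.
Qed.

(** Every deck of [tail_sorted m] comes from exactly one choice, so the one-step law
    is uniform on these decks. *)
Lemma shuffle_lawE (R : realType) :
  shuffle_law R m = fun x : G => (\sum_(y : G) tail_ind R m y)^-1 * tail_ind R m x.
Proof.
apply/funext => x; rewrite /shuffle_law card_shuffle_preimage mulrC; congr (_^-1 * _).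
rewrite -sum1_card natr_sum (partition_big (@shuffle_result n p) xpredT) //=.
apply: eq_bigr => y _; rewrite /tail_ind -card_shuffle_preimage -sum1_card natr_sum.
by apply: eq_bigl => w; rewrite [RHS]inE.
Qed.

End OneStep.

(** * Finite differences and absolutely monotone sequences *)

Section FiniteDifferences.
Variable R : realType.
Implicit Types f g : nat -> R.

Definition fdiff f : nat -> R := fun t => f t.+1 - f t.

Lemma iter_fdiffS j f s :
  iter j.+1 fdiff f s = iter j fdiff f s.+1 - iter j fdiff f s.
Proof. by []. Qed.

Lemma iter_fdiffD j f g s :
  iter j fdiff (fun t => f t + g t) s = iter j fdiff f s + iter j fdiff g s.
Proof. by elim: j s => [//|j IH] s; rewrite !iter_fdiffS !IH; ring. Qed.

Lemma iter_fdiffZ j a f s :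
  iter j fdiff (fun t => a * f t) s = a * iter j fdiff f s.
Proof. by elim: j s => [//|j IH] s; rewrite !iter_fdiffS !IH; ring. Qed.

Lemma iter_fdiff_shift j f s :
  iter j fdiff (fun t => f t.+1) s = iter j fdiff f s.+1.
Proof. by elim: j s => [//|j IH] s; rewrite !iter_fdiffS !IH. Qed.

Lemma iter_fdiff1 j s : iter j fdiff (fun=> 1) s = (j == 0%N)%:R.
Proof.
case: j => // j; rewrite iterSr (_ : fdiff (fun=> 1) = fun=> 0 * 0); last first.
  by apply/funext => t; rewrite /fdiff subrr mul0r.
by rewrite iter_fdiffZ mul0r.
Qed.

(** Leibniz's rule for a product with the identity.  At s = 0 the two terms
    mirror those of [convolution_tail_ind1], which gives [convolution_newton1]. *)
Lemma iter_fdiff_mulid j f s :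
  iter j fdiff (fun t => t%:R * f t) s =
  (s + j)%:R * iter j fdiff f s + j%:R * iter j.-1 fdiff f s.
Proof.
elim: j s => [|[|j] IH] s; first by rewrite /= addn0 mul0r addr0.
  by rewrite /= /fdiff; ring.
rewrite iter_fdiffS !IH -[j.+2.-1]/j.+1 -[j.+1.-1]/j.
rewrite [iter j.+2 _ _ _]iter_fdiffS [iter j.+1 _ _ s]iter_fdiffS.
ring.
Qed.

Lemma iter_fdiffE j f s :
  iter j fdiff f s = \sum_(i < j.+1) (-1) ^+ i * 'C(j, i)%:R * f (s + (j - i))%N.
Proof.
elim: j s => [|j IH] s; first by rewrite big_ord1 /= expr0 addn0 !mul1r.
rewrite iter_fdiffS !IH [in RHS]big_ord_recl /= expr0 bin0 mul1r subn0.
under [in RHS]eq_bigr do rewrite /= /bump leq0n add1n binS natrD mulrDr mulrDl exprS subSS.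
rewrite big_split /= [in RHS]big_ord_recr /= bin_small // mulr0 mul0r addr0.
rewrite big_ord_recl /= expr0 bin0 !mul1r subn0 addSnnS addrA; congr (_ + _ + _).
  apply: eq_bigr => i _; rewrite /= /bump leq0n add1n exprS addSnnS subnSK //.
rewrite -sumrN; apply: eq_bigr => i _; ring.
Qed.

(** Nonnegative differences are the form in which the positivity of the weights
    P(Z = z) is accessible: it is inherited by powers. *)
Definition absolutely_monotone f := forall j s, 0 <= iter j fdiff f s.

(** The difference of f g is f(t+1) (g(t+1) - g(t)) + (f(t+1) - f(t)) g(t), a sum of
    products of sequences of the same kind, with one difference less to take. *)
Lemma absolutely_monotoneM f g : absolutely_monotone f -> absolutely_monotone g ->
  absolutely_monotone (fun t => f t * g t).
Proof.
move=> + + j; elim: j f g => [|j IH] f g fP gP s.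
  by rewrite /= mulr_ge0 // ?(fP 0%N) ?(gP 0%N).
rewrite iterSr (_ : fdiff _ = fun t => f t.+1 * fdiff g t + fdiff f t * g t); last first.
  by apply/funext => t; rewrite /fdiff; ring.
rewrite iter_fdiffD addr_ge0 // IH // => i t.
- by rewrite iter_fdiff_shift.
- by rewrite -iterSr.
- by rewrite -iterSr.
Qed.

Lemma absolutely_monotoneX f k : absolutely_monotone f ->
  absolutely_monotone (fun t => f t ^+ k).
Proof.
move=> fP; elim: k => [|k IH].
  by move=> j s; rewrite (_ : (fun t => f t ^+ 0) = fun=> 1) ?iter_fdiff1.
rewrite (_ : (fun t => f t ^+ k.+1) = fun t => f t * f t ^+ k).
  exact: absolutely_monotoneM.
by apply/funext => t; rewrite exprS.
Qed.

Lemma absolutely_monotone_bin a m : 0 <= a ->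
  absolutely_monotone (fun t => a * 'C(t, m)%:R).
Proof.
move=> a0 j s; rewrite iter_fdiffZ mulr_ge0 //.
elim: m j s => [|m IH] j s.
  rewrite (_ : (fun t => 'C(t, 0)%:R) = fun=> 1) ?iter_fdiff1 //.
  by apply/funext => t; rewrite bin0.
case: j => [|j]; first by rewrite /= ler0n.
rewrite iterSr (_ : fdiff _ = fun t => 'C(t, m)%:R) //.
by apply/funext => t; rewrite /fdiff binS natrD addrC addKr.
Qed.

End FiniteDifferences.

(** * Powers of the one-step law as Newton series *)

Section NewtonSeries.
Variables (R : realType) (n p : nat).
Local Notation G := (colored_perm n p).
Implicit Types f g : nat -> R.

(** The value at X_1 / p of the function which agrees with f on 0, ..., n, by Newton's
    formula; the falling factorial of order j of X_1 / p is p^-j X_j. *)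
Definition newton_law f : G -> R := fun x =>
  \sum_(j < n.+1) iter j (@fdiff R) f 0 / (p ^ j * j`!)%:R * tail_ind R j x.

Lemma newton_law1 : newton_law (fun=> 1) = (fun x => (x == 1%g)%:R).
Proof.
apply/funext => x; rewrite /newton_law big_ord_recl big1 => [|i _].
  by rewrite /= mul1r invr1 mul1r addr0 /tail_ind tail_sorted0.
by rewrite iter_fdiff1 !mul0r.
Qed.

Lemma newton_lawZ a f x : newton_law (fun t => a * f t) x = a * newton_law f x.
Proof.
by rewrite /newton_law mulr_sumr; apply: eq_bigr => j _; rewrite iter_fdiffZ !mulrA.
Qed.

Lemma newton_lawD f g x :
  newton_law (fun t => f t + g t) x = newton_law f x + newton_law g x.
Proof.
rewrite /newton_law -big_split; apply: eq_bigr => j _.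
by rewrite iter_fdiffD /= !mulrDl.
Qed.

End NewtonSeries.

Section NewtonConvolution.
Variables (R : realType) (n' p : nat).
Hypothesis p_gt0 : (0 < p)%N.
Local Notation n := n'.+1.
Local Notation G := (colored_perm n p).
Local Notation newton := (@newton_law R n p).

Lemma convolution_newton1 f :
  convolution (newton f) (tail_ind R 1) = newton (fun t => p%:R * (t%:R * f t)).
Proof.
apply/funext => x; rewrite newton_lawZ convolution_suml /newton_law mulr_sumr.
under eq_bigr => j _ do rewrite convolution_tail_ind1 ?leq_ord // mulrDr.
under [RHS]eq_bigr => j _ do rewrite iter_fdiff_mulid add0n.
rewrite big_split /= [X in _ + X]big_ord_recr /= ltnn mul0r mulr0 addr0.
under [RHS]eq_bigr => j _ do rewrite !mulrDl mulrDr.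
rewrite [RHS]big_split /= [X in _ = _ + X]big_ord_recl /= !mul0r mulr0 add0r.
congr (_ + _); apply: eq_bigr => j _.
  by rewrite natrM; ring.
rewrite ltn_ord mul1r /bump leq0n add1n expnS factS !natrM.
have -> : (1 + j)%:R = j.+1%:R :> R by rewrite add1n.
by field; rewrite nat1r !pnatr_eq0 -!lt0n fact_gt0 expn_gt0 p_gt0.
Qed.

(** The recursion read as a formula for the next indicator: this is what makes
    [tail_ind m] the falling factorial of order m in [tail_ind 1]. *)
Lemma tail_indS m : (m < n)%N ->
  tail_ind R m.+1 = fun x : G =>
    convolution (tail_ind R m) (tail_ind R 1) x - (p * m)%:R * tail_ind R m x.
Proof.
move=> mn; apply/funext => x.
by rewrite convolution_tail_ind1 ?(ltnW mn) // mn mul1r addrC addKr.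
Qed.

Lemma ffact_natrS t m : (t ^_ m.+1)%:R = (t ^_ m)%:R * (t%:R - m%:R) :> R.
Proof.
rewrite ffactnSr natrM; have [mt|tm] := leqP m t; first by rewrite natrB.
by rewrite ffact_small // !mul0r.
Qed.

(** Multiplication by X_m is multiplication of the function by p^m times the falling
    factorial of order m. *)
Lemma convolution_newton f m : (m <= n)%N ->
  convolution (newton f) (tail_ind R m) =
  newton (fun t => (p ^ m)%:R * ((t ^_ m)%:R * f t)).
Proof.
elim: m => [|m IH] mn.
  rewrite (_ : tail_ind R 0 = fun x => (x == 1%g)%:R); last first.
    by apply/funext => x; rewrite /tail_ind tail_sorted0.
  apply/funext => x; rewrite newton_lawZ /= mul1r convolutionE (bigD1 1%g) //= eqxx.
  rewrite big1 => [|y /negPf ->]; last by rewrite mul0r.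
  rewrite invg1 mulg1 mul1r addr0; congr newton_law; apply/funext => t.
  by rewrite ffactn0 mul1r.
apply/funext => x; rewrite tail_indS // convolutionE.
under eq_bigr do rewrite mulrBl.
rewrite sumrB -convolutionE convolutionA IH ?(ltnW mn) // convolution_newton1.
under eq_bigr do rewrite -mulrA.
rewrite -mulr_sumr -convolutionE IH ?(ltnW mn) // -mulNr -newton_lawZ -newton_lawD.
congr newton_law; apply/funext => t.
by rewrite ffact_natrS expnS !natrM; ring.
Qed.

(** Counting the two sides of the recursion gives |B_(m+1)| = p (n - m) |B_m| for
    B_m the set of decks of [tail_sorted m]. *)
Lemma sum_tail_ind m : (m <= n)%N ->
  \sum_(x : G) tail_ind R m x = (p ^ m * n ^_ m)%:R.
Proof.
elim: m => [|m IH] mn.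
  rewrite (bigD1 (1%g : G)) //= big1 => [|y ne].
    by rewrite /tail_ind tail_sorted0 eqxx addr0 ffactn0.
  by rewrite /tail_ind tail_sorted0 (negPf ne).
rewrite tail_indS // sumrB sum_convolution -mulr_sumr IH ?(ltnW mn) //.
have -> : \sum_(x : G) tail_ind R 1 x = (n * p)%:R.
  under eq_bigr do rewrite -[tail_ind _ _ _]mulr1.
  rewrite (sum_tail_ind1 (fun=> 1)).
  under eq_bigr do rewrite sumr_const card_ord prednK //.
  by rewrite sumr_const card_ord -mulrnA mulnC.
rewrite [in RHS]natrM ffact_natrS expnS; move: (n ^_ m) => a; rewrite !natrM; ring.
Qed.

(** The normalized falling factorial t^_m / n^_m is C(t, m) / C(n, m), the eigenvalue
    of one step at t. *)
Lemma convolution_pow_shuffle_law m k : (m <= n)%N ->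
  convolution_pow (@shuffle_law R n p m) k =
  newton (fun t => ('C(n, m)%:R^-1 * 'C(t, m)%:R) ^+ k).
Proof.
move=> mn; elim: k => [|k IH] /=; first by rewrite -newton_law1.
rewrite IH shuffle_lawE // sum_tail_ind //; apply/funext => x.
rewrite convolutionE; under eq_bigr do rewrite -mulrA.
rewrite -mulr_sumr -convolutionE convolution_newton // -newton_lawZ.
congr newton_law; apply/funext => t; rewrite exprS -!bin_ffact !natrM.
by field; rewrite !pnatr_eq0 -!lt0n fact_gt0 expn_gt0 p_gt0 bin_gt0 mn.
Qed.

End NewtonConvolution.

(** * The density, and the two distances after k steps *)

Section TailLength.
Variables n p : nat.
Local Notation G := (colored_perm n p).
Implicit Types x : G.

Definition tail_len x : nat := \max_(z < n.+1 | tail_sorted (n - z) x) z.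

(** The sets of [tail_sorted] decks are nested, so the length of the tail determines
    all the indicators [tail_ind]. *)
Lemma leq_tail_len z x : (z <= n)%N -> (z <= tail_len x)%N = tail_sorted (n - z) x.
Proof.
move=> zn; apply/idP/idP => [|tz]; last first.
  by have := @leq_bigmax_cond _ (fun i : 'I_n.+1 => tail_sorted (n - i) x)
    (fun i : 'I_n.+1 => i : nat) (Ordinal (zn : (z < n.+1)%N)) tz.
pose A := [pred i : 'I_n.+1 | tail_sorted (n - i) x].
have : (0 < #|A|)%N.
  by apply/card_gt0P; exists ord0; rewrite inE subn0 tail_sorted_full.
move=> /(eq_bigmax_cond (fun i : 'I_n.+1 => i : nat)) [i0 i0A] /= e.
rewrite /tail_len e => zi0; apply: tail_sortedW i0A.
exact: leq_sub2l.
Qed.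

Lemma tail_len_le x : (tail_len x <= n)%N.
Proof. by apply/bigmax_leqP => i _; rewrite -ltnS. Qed.

End TailLength.

Section UntouchedCards.
Variables (R : realType) (n m k : nat).

(** The probability that exactly z cards are untouched after k steps, in the form of
    a Newton coefficient; [untouched_probE] is the inclusion-exclusion formula for
    it. *)
Definition untouched_prob (z : nat) : R :=
  'C(n, z)%:R * iter (n - z) (@fdiff R) (fun t => ('C(n, m)%:R^-1 * 'C(t, m)%:R) ^+ k) 0.

Lemma untouched_prob_ge0 z : 0 <= untouched_prob z.
Proof.
rewrite mulr_ge0 //; apply: absolutely_monotoneX.
by apply: absolutely_monotone_bin; rewrite invr_ge0.
Qed.

Definition density (p l : nat) : R :=
  \sum_(z < l.+1) (z`! * p ^ z)%:R * untouched_prob z.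

Lemma density_homo p l l' : (l <= l')%N -> density p l <= density p l'.
Proof.
move=> ll'; rewrite /density -(subnKC ll') -addSn big_split_ord /= lerDl.
by apply: sumr_ge0 => i _; rewrite mulr_ge0 // untouched_prob_ge0.
Qed.

End UntouchedCards.

Section LawOfTailLength.
Variables (R : realType) (n' p : nat).
Hypothesis p_gt0 : (0 < p)%N.
Local Notation n := n'.+1.
Local Notation G := (colored_perm n p).

Definition tail_prob (l : nat) : R := ((l`! * p ^ l)%N%:R)^-1.

Lemma card_deck : #|{: G}|%:R = (p ^ n * n`!)%:R :> R.
Proof. by rewrite card_colored_perm. Qed.

Lemma card_deck_neq0 : #|{: G}|%:R != 0 :> R.
Proof. by rewrite card_deck pnatr_eq0 -lt0n muln_gt0 expn_gt0 p_gt0 fact_gt0. Qed.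

Lemma sum_leq_tail_len l : (l <= n)%N ->
  \sum_(x : G) (l <= tail_len x)%:R = #|{: G}|%:R * tail_prob l.
Proof.
move=> ln; under eq_bigr do rewrite leq_tail_len // -[_%:R]/(tail_ind R (n - l) _).
rewrite sum_tail_ind ?leq_subr // card_deck /tail_prob.
rewrite -(ffact_fact (leq_subr l n)) subKn //.
have -> : (p ^ n = p ^ (n - l) * p ^ l)%N by rewrite -expnD subnK.
by rewrite !natrM; field; rewrite !pnatr_eq0 -!lt0n fact_gt0 expn_gt0 p_gt0.
Qed.

Lemma sum_eq_tail_len l : (l < n)%N ->
  \sum_(x : G) (tail_len x == l)%:R = #|{: G}|%:R * a_coef R p l.
Proof.
move=> ln; rewrite mulrBr -!sum_leq_tail_len //; last exact: ltnW.
rewrite -sumrB; apply: eq_bigr => x _.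
by case: ltngtP; rewrite ?subrr ?subr0.
Qed.

Lemma a_coef_ge0 l : 0 <= a_coef R p l.
Proof.
rewrite subr_ge0 lef_pV2 ?posrE ?ltr0n ?muln_gt0 ?fact_gt0 ?expn_gt0 ?p_gt0 //.
have pX : (0 < p ^ l)%N by rewrite expn_gt0 p_gt0.
by rewrite ler_nat factS expnS; have := fact_gt0 l; nia.
Qed.

Lemma tail_prob_ge0 l : 0 <= tail_prob l.
Proof. by rewrite invr_ge0. Qed.

Lemma tail_len_witness l : (l < n)%N -> 0 < a_coef R p l -> exists x : G, tail_len x = l.
Proof.
move=> ln al; case: (pickP (fun x : G => tail_len x == l)) => [x /eqP|none]; first by exists x.
have := sum_eq_tail_len ln; rewrite big1 => [|x _]; last by rewrite none.
move/eqP; rewrite eq_sym mulf_eq0 (negPf card_deck_neq0) /= => /eqP e.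
by rewrite e ltxx in al.
Qed.

(** The decks with a tail of length at least M have probability at most [tail_prob M]
    and contribute at most 1 each; as M <= n, the law of [tail_len] is given by
    [a_coef] on the shorter ones. *)
Lemma tail_len_average_approx (h : nat -> R) M : (M <= n)%N ->
  (forall x : G, 0 <= h (tail_len x) <= 1) ->
  `| #|{: G}|%:R^-1 * \sum_(x : G) h (tail_len x)
     - \sum_(l < M) a_coef R p l * h l| <= tail_prob M.
Proof.
move=> Mn h01.
have -> : \sum_(l < M) a_coef R p l * h l =
  #|{: G}|%:R^-1 * \sum_(x : G) (tail_len x < M)%:R * h (tail_len x).
  transitivity (\sum_(l < M) (#|{: G}|%:R^-1 * \sum_(x : G) (tail_len x == l)%:R) * h l).
    apply: eq_bigr => l _.
    by rewrite sum_eq_tail_len ?(leq_trans (ltn_ord l)) // mulKf // card_deck_neq0.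
  under eq_bigr do rewrite -mulrA mulr_suml.
  rewrite -mulr_sumr exchange_big; congr (_ * _); apply: eq_bigr => x _ /=.
  case: ltnP => [lt|ge].
    rewrite (bigD1 (Ordinal lt)) //= eqxx big1 ?addr0 // => l.
    by rewrite -val_eqE /= eq_sym => /negPf ->; rewrite mul0r.
  rewrite mul0r big1 // => l _.
  by rewrite gtn_eqF ?mul0r // (leq_trans (ltn_ord l)).
rewrite -mulrBr -sumrB normrM ger0_norm ?invr_ge0 ?ler0n //.
rewrite ler_pdivrMl ?lt0r ?card_deck_neq0 ?ler0n // -sum_leq_tail_len //.
apply: le_trans (ler_norm_sum _ _ _) _; apply: ler_sum => x _.
have /andP [h0 h1] := h01 x.
by case: leqP => _; rewrite ?mul1r ?mul0r ?subrr ?subr0 ?normr0 // ger0_norm.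
Qed.

Variables (m : nat).
Hypothesis m_le_n : (m <= n)%N.

(** In terms of z = n - j, the coefficient of X_j in the Newton series, divided by the
    uniform probability, is z! p^z times the weight of z. *)
Lemma convolution_pow_density k (x : G) :
  convolution_pow (@shuffle_law R n p m) k x = density R n m k p (tail_len x) / #|{: G}|%:R.
Proof.
rewrite convolution_pow_shuffle_law // /newton_law (reindex_inj rev_ord_inj) /=.
rewrite /density mulr_suml.
rewrite (big_ord_widen n.+1
  (fun z => (z`! * p ^ z)%:R * untouched_prob R n m k z / #|{: G}|%:R));
  last by rewrite ltnS tail_len_le.
rewrite [RHS]big_mkcond; apply: eq_bigr => z _ /=; have zn : (z <= n)%N by rewrite -ltnS.
rewrite subSS /tail_ind ltnS leq_tail_len //; case: tail_sorted; last by rewrite mulr0.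
rewrite mulr1 /untouched_prob card_deck.
move: (iter _ _ _ _) => d.
have -> : (p ^ n = p ^ (n - z) * p ^ z)%N by rewrite -expnD subnK.
rewrite -(bin_fact zn) !natrM.
field; rewrite !pnatr_eq0 -!lt0n !fact_gt0 !expn_gt0 !p_gt0 bin_gt0 zn //.
Qed.

Local Notation law k := (convolution_pow (@shuffle_law R n p m) k).

Lemma shuffle_law_ge0 x : 0 <= @shuffle_law R n p m x.
Proof. by rewrite divr_ge0. Qed.

Lemma sum_shuffle_law : \sum_x @shuffle_law R n p m x = 1.
Proof.
rewrite shuffle_lawE // -mulr_sumr mulVf // sum_tail_ind // pnatr_eq0 -lt0n.
by rewrite muln_gt0 expn_gt0 p_gt0 ffact_gt0.
Qed.

Lemma density_tail_len_ge0 k (x : G) : 0 <= density R n m k p (tail_len x).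
Proof.
have := convolution_pow_ge0 k x shuffle_law_ge0.
by rewrite convolution_pow_density pmulr_lge0 // invr_gt0 lt0r card_deck_neq0 ler0n.
Qed.

(** Since |u| = 2 max(-u, 0) + u and the total masses agree. *)
Lemma tv_dist_positive_part (gT : finGroupType) (M N : gT -> R) :
  \sum_x M x = \sum_x N x -> tv_dist M N = \sum_x Num.max (N x - M x) 0.
Proof.
move=> e; rewrite /tv_dist.
transitivity (2^-1 * (\sum_x `|M x - N x| + (\sum_x N x - \sum_x M x))).
  by rewrite e subrr addr0.
rewrite -sumrB -big_split /= mulr_sumr; apply: eq_bigr => x _.
by case: (lerP (N x - M x) 0); case: (ler0P (M x - N x)); lra.
Qed.

Lemma shuffle_tv_density k :
  tv_dist (law k) (uniform_law R G) =
  #|{: G}|%:R^-1 * \sum_(x : G) Num.max (1 - density R n m k p (tail_len x)) 0.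
Proof.
rewrite tv_dist_positive_part; last first.
  rewrite sum_convolution_pow ?sum_shuffle_law // /uniform_law sumr_const.
  by rewrite -[LHS](mulVf card_deck_neq0) mulr_natr.
rewrite mulr_sumr; apply: eq_bigr => x _; rewrite convolution_pow_density /uniform_law.
rewrite maxr_pMr ?invr_ge0 // mulr0; congr Num.max; ring.
Qed.

(** The positive part of U - Q is used rather than that of Q - U because the
    function 1 - g is at most 1, which bounds the contribution of the long tails
    independently of the shuffle. *)
Lemma shuffle_tv_approx k M : (M <= n)%N ->
  `|tv_dist (law k) (uniform_law R G)
    - \sum_(l < M) a_coef R p l * Num.max (1 - density R n m k p l) 0| <= tail_prob M.
Proof.
move=> Mn; rewrite shuffle_tv_density.
apply: (@tail_len_average_approx (fun l => Num.max (1 - density R n m k p l) 0)) => // x.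
rewrite le_max lexx orbT ge_max ler01 andbT.
by rewrite lerBlDr lerDl density_tail_len_ge0.
Qed.

(** The density increases with the length of the tail, so it is least at the decks
    with the shortest tail. *)
Lemma shuffle_sep_density k l : (l < n)%N -> 0 < a_coef R p l ->
  (forall x : G, l <= tail_len x)%N ->
  sep_dist (law k) (uniform_law R G) = 1 - density R n m k p l.
Proof.
move=> ln al lmin.
have E (x : G) : 1 - law k x / uniform_law R G x = 1 - density R n m k p (tail_len x).
  by rewrite convolution_pow_density /uniform_law invrK divfK // card_deck_neq0.
have le (x : G) : 1 - law k x / uniform_law R G x <= 1 - density R n m k p l.
  by rewrite E lerB // density_homo.
have [x0 x0l] := tail_len_witness ln al.
apply/eqP; rewrite eq_le; apply/andP; split.
  by apply/bigmax_leP.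
by rewrite -{1}x0l -E; apply: le_bigmax.
Qed.

(** With a single color the last card alone is always in order, so the shortest tail
    has length 1. *)
Lemma shuffle_sep_one_color k : p = 1%N -> (1 < n)%N ->
  sep_dist (law k) (uniform_law R G) = 1 - density R n m k p 1.
Proof.
move=> p1 n1; apply: shuffle_sep_density => //.
  by rewrite /a_coef p1 !exp1n !muln1 subr_gt0 ltf_pV2 ?posrE ?ltr0n ?ltr_nat.
move=> x; rewrite leq_tail_len // subn1 /=; apply/tail_sortedP; split=> [i _|i i'].
  by apply/val_inj; case: (card_color x i) => -[|c]; rewrite p1.
by move=> /andP [ni ii']; have := ltn_ord i'; rewrite ltnS leqNgt (leq_ltn_trans ni ii').
Qed.

Lemma shuffle_sep_many_colors k : (1 < p)%N ->
  sep_dist (law k) (uniform_law R G) = 1 - density R n m k p 0.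
Proof.
move=> p2; apply: shuffle_sep_density => //.
rewrite /a_coef !fact0 expn0 expn1 !mul1n subr_gt0.
by rewrite ltf_pV2 ?posrE ?ltr0n ?ltr_nat.
Qed.

End LawOfTailLength.

(** * Interchange of limits and sums *)

Section Limits.
Variable R : realType.

(** Limits may be taken after truncation at M when the truncation errors are bounded
    uniformly in n by a quantity that vanishes with M. *)
Lemma cvg_truncation (u : nat -> R) (L : R) (v : nat -> nat -> R) (l e : nat -> R) :
  e @ \oo --> (0 : R) ->
  (forall M, \forall n \near \oo, `|u n - v M n| <= e M) ->
  (forall M, v M @ \oo --> l M) -> (forall M, `|l M - L| <= e M) ->
  u @ \oo --> L.
Proof.
move=> e0 uv vl lL; apply/cvgrPdist_lt => eps eps0.
have eps3 : 0 < eps / 3 by lra.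
have /cvgrPdist_lt /(_ _ eps3) [M _ /(_ M (leqnn M))] := e0.
rewrite sub0r normrN => eM; have {eM} eM := le_lt_trans (ler_norm _) eM.
near=> n.
have h1 : `|u n - v M n| <= e M by near: n; apply: uv.
have h2 : `|l M - v M n| < eps / 3.
  by near: n; move: (vl M) => /cvgrPdist_lt; apply.
have h3 := lL M.
rewrite (_ : L - u n = (l M - v M n) - (u n - v M n) - (l M - L)); last by ring.
apply: le_lt_trans (ler_normB _ _) _.
have := ler_normB (l M - v M n) (u n - v M n); lra.
Unshelve. all: by end_near. Qed.

(** Dominated convergence for series with a growing number of terms: the tails of
    the dominating series bound the truncation errors. *)
Lemma tannery (F : nat -> nat -> R) (G B : nat -> R) (N : nat -> nat) (L : R) :
  cvgn (series B) -> (\forall n \near \oo, forall s, `|F n s| <= B s) ->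
  (forall s, F ^~ s @ \oo --> G s) -> N @ \oo --> \oo -> series G @ \oo --> L ->
  (fun n => \sum_(0 <= s < N n) F n s) @ \oo --> L.
Proof.
move=> Bcvg FB FG Noo GL.
have B0 s : 0 <= B s.
  by near \oo => n; apply: le_trans (normr_ge0 (F n s)) _; near: n; apply: filterS FB.
have GB s : `|G s| <= B s.
  apply: (@cvgr_to_le _ \oo _ _ (fun n => `|F n s|)).
    by apply: cvg_norm; apply: FG.
  by apply: filterS FB => n /(_ s).
have tailB M M' : (M <= M')%N ->
    \sum_(M <= s < M') B s <= limn (series B) - series B M.
  move=> MM'; rewrite -sub_series_geq // lerD2r.
  apply: nondecreasing_cvgn_le => // a b ab.
  by rewrite -subr_ge0 sub_series_geq // sumr_ge0.
apply: (@cvg_truncation _ _ (fun M n => \sum_(0 <= s < M) F n s) (series G)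
  (fun M => limn (series B) - series B M)) => [||M|M].
- rewrite -[X in _ --> X](subrr (limn (series B))).
  by apply: cvgB => //; exact: cvg_cst.
- move=> M; near=> n.
  have MN : (M <= N n)%N by near: n; exact: (Noo _ (nbhs_infty_ge M)).
  rewrite (big_cat_nat (leq0n M) MN) //= addrAC subrr add0r.
  apply: le_trans (tailB _ _ MN); apply: le_trans (ler_norm_sum _ _ _) _.
  apply: ler_sum => s _; move: s; near: n; exact: FB.
- by apply: cvg_big => [|s _]; [exact: add_continuous | exact: FG].
- rewrite distrC; apply: (@cvgr_to_le _ \oo _ _ (fun M' => `|series G M' - series G M|)).
    by apply: cvg_norm; apply: cvgB => //; exact: cvg_cst.
  near=> M'; have MM' : (M <= M')%N by near: M'; exists M.
  rewrite sub_series_geq //; apply: le_trans (tailB _ _ MM').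
  by apply: le_trans (ler_norm_sum _ _ _) _; apply: ler_sum.
Unshelve. all: by end_near. Qed.

Lemma cvg_inv_nat : (fun n : nat => n%:R^-1 : R) @ \oo --> (0 : R).
Proof. by apply/gtr0_cvgV0; [exact: nbhs_infty_gtr | exact: cvgr_idn]. Qed.

Lemma cvg_ln_nat : (fun n : nat => ln n%:R : R) @ \oo --> +oo.
Proof.
apply/cvgryPge => A; near=> n.
have n0 : (0 : R) < n%:R by apply: lt_le_trans (expR_gt0 A) _; near: n; exact: nbhs_infty_ger.
by rewrite -ler_expR lnK ?posrE //; near: n; exact: nbhs_infty_ger.
Unshelve. all: by end_near. Qed.

Lemma cvg_invr_ln_nat : (fun n : nat => (ln n%:R)^-1 : R) @ \oo --> (0 : R).
Proof.
apply/gtr0_cvgV0; last exact: cvg_ln_nat.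
by have /cvgryPgt := cvg_ln_nat; apply.
Qed.

Lemma cvg_ln_div_nat c : (fun n : nat => (ln n%:R + c) / n%:R : R) @ \oo --> (0 : R).
Proof.
rewrite (_ : (fun n => _) = fun n : nat => ln n%:R / n%:R + c * n%:R^-1); last first.
  by apply/funext => n; rewrite mulrDl.
rewrite -[X in _ --> X](addr0 0) -[X in _ --> _ + X](mulr0 c); apply: cvgD; last first.
  exact: cvgMl_tmp cvg_inv_nat.
apply: (@squeeze_cvgr _ _ _ _ (fun=> 0) (fun n : nat => 2 * (ln n%:R)^-1)); last first.
- by rewrite -[X in _ --> X](mulr0 2); exact: cvgMl_tmp cvg_invr_ln_nat.
- exact: cvg_cst.
near=> n.
have n0 : (0 : R) < n%:R by near: n; exact: nbhs_infty_gtr.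
have l0 : (0 : R) < ln n%:R by near: n; have /cvgryPgt := cvg_ln_nat; apply.
apply/andP; split; first by rewrite divr_ge0 ?ltW.
rewrite ler_pdivrMr // mulrC mulrA ler_pdivlMr // -expr2.
(* With L = ln n this is 1 + L^2 / 2 <= exp L = n. *)
have := expR_ge1Dxn 1 (ltW l0); rewrite lnK ?posrE // (_ : 2`!%:R = 2 :> R) //.
move: (ln n%:R ^+ 2) => a; lra.
Unshelve. all: by end_near. Qed.

Lemma bernoulli_inequality (y : R) k : 0 <= y <= 1 -> 1 - k%:R * y <= (1 - y) ^+ k.
Proof.
move=> /andP [y0 y1]; elim: k => [|k IH]; first by rewrite mul0r subr0 expr0.
rewrite exprS; have h : 0 <= (1 - y) by lra.
apply: le_trans (ler_wpM2l h IH); rewrite -natr1.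
have : 0 <= k%:R * y * y by rewrite !mulr_ge0.
lra.
Qed.

End Limits.

(** * Binomial moments of the number of untouched cards *)

Lemma bin_trinomial a b c : (a + b <= c)%N ->
  ('C(c, a) * 'C(c - a, b) = 'C(c, a + b) * 'C(a + b, a))%N.
Proof.
move=> abc; have ac : (a <= c)%N by apply: leq_trans abc; rewrite leq_addr.
have bca : (b <= c - a)%N by rewrite leq_subRL.
have h1 := bin_fact ac; have h2 := bin_fact bca; have h3 := bin_fact abc.
have h4 := bin_fact (leq_addr b a); rewrite addKn in h4; rewrite -subnDA in h2.
apply/eqP; rewrite -(eqn_pmul2r (fact_gt0 a)) -(eqn_pmul2r (fact_gt0 b)).
rewrite -(eqn_pmul2r (fact_gt0 (c - (a + b)))); apply/eqP.
transitivity (c`!); first by rewrite -h1 -h2; ring.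
by rewrite -h3 -h4; ring.
Qed.

Section BinomialMoments.
Variables (R : realType) (n m k : nat).
Hypothesis m_le_n : (m <= n)%N.

(** The expectation of C(Z, r): the number of r-sets of cards times the probability
    that a given one is avoided by k sets of size m. *)
Definition binomial_moment (r : nat) : R :=
  'C(n, r)%:R * ('C(n, m)%:R^-1 * 'C(n - r, m)%:R) ^+ k.

(** The quotient of consecutive factorial moments, r! [binomial_moment r]. *)
Definition moment_ratio (r : nat) : R :=
  (n - r)%:R * ((n - r - m)%:R / (n - r)%:R) ^+ k.

Lemma binomial_moment0 : binomial_moment 0 = 1.
Proof.
by rewrite /binomial_moment bin0 subn0 mulVf ?expr1n ?mulr1 // pnatr_eq0 -lt0n bin_gt0.
Qed.

Lemma binomial_momentS r : (r < n)%N ->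
  binomial_moment r.+1 = binomial_moment r * moment_ratio r / r.+1%:R.
Proof.
move=> rn; rewrite /binomial_moment /moment_ratio.
have nr0 : (n - r)%:R != 0 :> R by rewrite pnatr_eq0 -lt0n subn_gt0.
have -> : 'C(n - r.+1, m)%:R = 'C(n - r, m)%:R * ((n - r - m)%:R / (n - r)%:R) :> R.
  apply: (mulIf nr0); rewrite mulrA divfK // -!natrM mulnC subnS.
  by rewrite mul_bin_down mulnC.
have -> : 'C(n, r.+1)%:R = 'C(n, r)%:R * (n - r)%:R / r.+1%:R :> R.
  have r0 : r.+1%:R != 0 :> R by rewrite pnatr_eq0.
  by apply: (mulIf r0); rewrite divfK // -!natrM mulnC mul_bin_left mulnC.
rewrite [in LHS]mulrA [in LHS]exprMn.
by move: (_ ^+ k) (_ ^+ k) => a b; ring.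
Qed.

Lemma moment_ratio_ge0 r : 0 <= moment_ratio r.
Proof. by rewrite mulr_ge0 // exprn_ge0 // divr_ge0. Qed.

Lemma binomial_moment_ge0 r : 0 <= binomial_moment r.
Proof. by rewrite mulr_ge0 // exprn_ge0 // mulr_ge0 // invr_ge0. Qed.

(** The fraction (n - r - m) / (n - r) decreases in r, so every ratio is at most the
    mean, which is the one for r = 0. *)
Lemma moment_ratio_le r : (r < n)%N ->
  moment_ratio r <= n%:R * (1 - m%:R / n%:R) ^+ k.
Proof.
move=> rn; have n0 : (0 < n)%N by apply: leq_ltn_trans rn.
rewrite /moment_ratio ler_pM ?exprn_ge0 ?divr_ge0 // ?ler_nat ?leq_subr //.
rewrite lerXn2r ?nnegrE ?divr_ge0 //.
  by rewrite subr_ge0 ler_pdivrMr ?ltr0n // mul1r ler_nat.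
have -> : 1 - m%:R / n%:R = (n - m)%:R / n%:R :> R.
  by rewrite natrB // mulrBl divff // pnatr_eq0 -lt0n.
rewrite ler_pdivrMr ?ltr0n ?subn_gt0 // mulrAC ler_pdivlMr ?ltr0n //.
rewrite -!natrM ler_nat; nia.
Qed.

Lemma binomial_moment_le r :
  binomial_moment r <= (n%:R * (1 - m%:R / n%:R) ^+ k) ^+ r / r`!%:R.
Proof.
set lam := n%:R * _.
have lam0 : 0 <= lam.
  rewrite mulr_ge0 // exprn_ge0 //; case: (n) m_le_n => [|n'] mn.
    by rewrite invr0 mulr0 subr0.
  by rewrite subr_ge0 ler_pdivrMr ?ltr0n // mul1r ler_nat.
elim: r => [|r IH]; first by rewrite binomial_moment0 expr0 divr1.
have [rn|nr] := ltnP r n; last first.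
  by rewrite /binomial_moment bin_small // mul0r divr_ge0 ?exprn_ge0.
rewrite binomial_momentS // factS natrM invfM [_ ^+ r.+1]exprSr.
rewrite [r.+1%:R^-1 * _]mulrC [_ * (_ / _)]mulrA ler_wpM2r ?invr_ge0 //.
rewrite [leRHS]mulrAC.
by rewrite ler_pM ?binomial_moment_ge0 ?moment_ratio_ge0 ?moment_ratio_le //.
Qed.

(** The law of Z in terms of its binomial moments. *)
Lemma untouched_probE z : (z <= n)%N -> untouched_prob R n m k z =
  \sum_(0 <= s < (n - z).+1)
     (-1) ^+ s * 'C(z + s, z)%:R * binomial_moment (z + s).
Proof.
move=> zn; rewrite /untouched_prob iter_fdiffE mulr_sumr big_mkord.
apply: eq_bigr => s _; have sn : (s <= n - z)%N by rewrite -ltnS.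
rewrite add0n -subnDA /binomial_moment.
have := @bin_trinomial z s n; rewrite -leq_subRL // => /(_ sn).
move=> /(congr1 (fun a => a%:R : R)); rewrite !natrM => e.
transitivity ((-1) ^+ s * ('C(n, z)%:R * 'C(n - z, s)%:R) *
   ('C(n, m)%:R^-1 * 'C(n - (z + s), m)%:R) ^+ k : R); first ring.
by rewrite e; ring.
Qed.

End BinomialMoments.

(** * The Poisson limit *)

(** The ratio differs from the mean n (1 - m/n)^k by the factor (1 - r/n) (1 - y)^k
    with y = m r / ((n - m) (n - r)), which is of order m r / n^2; Bernoulli's
    inequality bounds the power below by 1 - k y, and k m <= n T; in the
    application T is of order ln n. *)
Lemma moment_ratio_ge (R : realType) (n m k r : nat) (T : R) :
  (2 * r.+1 <= n)%N -> (2 * m <= n)%N -> k%:R * m%:R <= n%:R * T ->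
  n%:R * (1 - m%:R / n%:R) ^+ k * ((1 - r%:R / n%:R) * (1 - 4 * r%:R * (T / n%:R)))
    <= moment_ratio R n m k r.
Proof.
move=> rn mn.
have [n0N mnN rnN rmnN] : [/\ (0 < n)%N, (m < n)%N, (r < n)%N & (m <= n - r)%N] by split; lia.
have anN : (n <= 2 * (n - m))%N by lia.
have bnN : (n <= 2 * (n - r))%N by lia.
have yN : (m * r <= (n - m) * (n - r))%N by nia.
have n0 : (0 : R) < n%:R by rewrite ltr0n.
move=> km; have T0 : 0 <= T by rewrite -(pmulr_rge0 _ n0) (le_trans _ km) // mulr_ge0.
rewrite /moment_ratio; set a := (n - m)%:R : R; set b := (n - r)%:R : R.
have a0 : 0 < a by rewrite ltr0n subn_gt0.
have b0 : 0 < b by rewrite ltr0n subn_gt0.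
have an : n%:R <= 2 * a by rewrite /a -natrM ler_nat.
have bn : n%:R <= 2 * b by rewrite /b -natrM ler_nat.
pose y := m%:R * r%:R / (a * b).
have y01 : 0 <= y <= 1.
  rewrite divr_ge0 ?mulr_ge0 ?(ltW a0) ?(ltW b0) //=.
  by rewrite ler_pdivrMr ?mulr_gt0 // mul1r /a /b -!natrM ler_nat.
have aE : a = n%:R - m%:R by rewrite /a natrB // ltnW.
have bE : b = n%:R - r%:R by rewrite /b natrB // ltnW.
(* For r = 0 the left-hand side is the first factor, so y is the relative change. *)
have E : (n - r - m)%:R / b = (1 - m%:R / n%:R) * (1 - y).
  rewrite natrB // -/b /y aE bE; rewrite aE in a0; rewrite bE in b0.
  by field; rewrite ?gt_eqF.
rewrite E exprMn (_ : b = n%:R * (1 - r%:R / n%:R)); last first.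
  by rewrite mulrBr mulr1 mulrC divfK ?gt_eqF.
have frac_ge0 (j : nat) : (j < n)%N -> 0 <= 1 - j%:R / n%:R :> R.
  by move=> jn; rewrite subr_ge0 ler_pdivrMr // mul1r ler_nat ltnW.
rewrite mulrACA; apply: ler_wpM2l; first by rewrite mulr_ge0 // frac_ge0.
apply: ler_wpM2l; first by rewrite exprn_ge0 // frac_ge0.
apply: le_trans (bernoulli_inequality k y01); rewrite lerD2l lerN2 /y.
rewrite (_ : k%:R * _ = k%:R * m%:R * r%:R / (a * b)); last by ring.
rewrite (_ : 4 * r%:R * _ = 4 * r%:R * T / n%:R); last by ring.
rewrite ler_pdivrMr ?mulr_gt0 // [leRHS]mulrAC ler_pdivlMr //.
apply: (@le_trans _ _ (n%:R * T * r%:R * n%:R)).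
  by rewrite ler_wpM2r // ler_wpM2r.
rewrite (_ : n%:R * T * r%:R * n%:R = T * r%:R * (n%:R * n%:R)); last by ring.
rewrite (_ : 4 * r%:R * T * (a * b) = T * r%:R * (2 * a * (2 * b))); last by ring.
by rewrite ler_wpM2l ?mulr_ge0 // ler_pM // ltW.
Qed.


Section PoissonLimit.
Variables (R : realType) (m : nat -> nat).
Hypothesis m_bounds : forall n : nat, (2 <= n)%N -> (1 <= m n <= n - 1)%N.
Hypothesis m_small : (fun n : nat => (m n)%:R / n%:R : R) @ \oo --> (0 : R).

Local Notation x n := ((m n)%:R / n%:R : R).
Local Notation lam c n := (n%:R * (1 - x n) ^+ steps m c n : R).

Lemma m_frac_bounds n : (2 <= n)%N -> 0 < x n < 1.
Proof.
move=> n2; have /andP [m1 mn] := m_bounds n2.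
have n0 : (0 < n%:R :> R) by rewrite ltr0n; lia.
apply/andP; split; first by rewrite divr_gt0 // ltr0n.
by rewrite ltr_pdivrMr // mul1r ltr_nat; lia.
Qed.

(** Both bounds are ln (1 + u) <= u, for u = - m/n and for u = (m/n) / (1 - m/n). *)
Lemma delta_bounds n : (2 <= n)%N -> x n <= delta R m n <= x n / (1 - x n).
Proof.
move=> /m_frac_bounds /andP []; rewrite /delta; move: (x n) => y y0 y1.
apply/andP; split.
  by rewrite lerNr; have := @le_ln1Dx R (- y); apply; lra.
have y1' : 0 < 1 - y by lra.
rewrite -lnV ?posrE // (_ : ln (1 - y)^-1 = ln (1 + y / (1 - y))); last first.
  by congr ln; field; lra.
by apply: le_ln1Dx; apply: lt_le_trans (divr_ge0 (ltW y0) (ltW y1')); lra.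
Qed.

Lemma delta_gt0 n : (2 <= n)%N -> 0 < delta R m n.
Proof.
move=> n2; have /andP [x0 _] := m_frac_bounds n2.
by have /andP [+ _] := delta_bounds n2; apply: lt_le_trans.
Qed.

Lemma cvg_frac_div_delta : (fun n => x n / delta R m n) @ \oo --> (1 : R).
Proof.
apply: (@squeeze_cvgr _ _ _ _ (fun n => 1 - x n) (fun=> 1)); last exact: cvg_cst.
- near=> n; have n2 : (2 <= n)%N by near: n; exact: nbhs_infty_ge.
  have d0 := delta_gt0 n2; have /andP [x0 x1] := m_frac_bounds n2.
  have /andP [d1 d2] := delta_bounds n2; apply/andP; split.
    by rewrite ler_pdivlMr // mulrC -ler_pdivlMr // subr_gt0.
  by rewrite ler_pdivrMr // mul1r.
- by rewrite -[X in _ --> X](subr0 1); apply: cvgB => //; exact: cvg_cst.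
Unshelve. all: by end_near. Qed.

Lemma cvg_delta : delta R m @ \oo --> (0 : R).
Proof.
rewrite /delta -oppr0 -[X in - X]ln1; apply: cvgN.
have x1 : (fun n => 1 - x n) @ \oo --> (1 : R).
  by rewrite -[X in _ --> X](subr0 1); apply: cvgB => //; exact: cvg_cst.
exact: (continuous_cvg _ (@continuous_ln R 1 ltr01) x1).
Qed.

Lemma near_steps c : \forall n \near \oo,
  (steps m c n)%:R * delta R m n <= ln n%:R + c < ((steps m c n)%:R + 1) * delta R m n.
Proof.
near=> n; have n2 : (2 <= n)%N by near: n; exact: nbhs_infty_ge.
have d0 := delta_gt0 n2.
have l0 : 0 <= ln n%:R + c.
  have : - c <= ln n%:R by near: n; have /cvgryPge := @cvg_ln_nat R; apply.
  lra.
have /truncn_itv : 0 <= (ln n%:R + c) / delta R m n by rewrite divr_ge0 // ltW.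
by rewrite ler_pdivlMr // ltr_pdivrMr // -natr1.
Unshelve. all: by end_near. Qed.

(** Since 1 - m/n = exp (- delta), the mean is exp (ln n - k delta), and the rounding
    of k changes the exponent by at most delta, which tends to 0. *)
Lemma cvg_mean_untouched c : (fun n => lam c n) @ \oo --> expR (- c).
Proof.
have E : (fun n => expR (ln n%:R - (steps m c n)%:R * delta R m n)) @ \oo --> expR (- c).
  have : (fun n => ln n%:R - (steps m c n)%:R * delta R m n) @ \oo --> - c; last first.
    by move=> h; exact: (continuous_cvg _ (@continuous_expR R (- c)) h).
  apply: (@squeeze_cvgr _ _ _ _ (fun=> - c) (fun n => - c + delta R m n)).
  - near=> n; have : (steps m c n)%:R * delta R m n <= ln n%:R + c <
      ((steps m c n)%:R + 1) * delta R m n by near: n; exact: near_steps.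
    lra.
  - exact: cvg_cst.
  - by rewrite -[X in _ --> X](addr0 (- c)); apply: cvgD; [exact: cvg_cst | exact: cvg_delta].
apply: cvg_trans E; apply: near_eq_cvg; near=> n.
have n2 : (2 <= n)%N by near: n; exact: nbhs_infty_ge.
have /andP [x0 x1] := m_frac_bounds n2.
rewrite expRB lnK; last by rewrite posrE ltr0n; lia.
rewrite expRM_natl {1}/delta expRN lnK ?posrE ?subr_gt0 // exprVn invrK //.
Unshelve. all: by end_near. Qed.

Lemma near_m_le_half : \forall n \near \oo, (2 * m n <= n)%N.
Proof.
have h : (0 : R) < 2^-1 by rewrite invr_gt0.
near=> n; have n2 : (2 <= n)%N by near: n; exact: nbhs_infty_ge.
have : x n < 2^-1.
  near: n; have /cvgrPdist_lt /(_ _ h) := m_small; apply: filterS => n.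
  by rewrite sub0r normrN; apply: le_lt_trans; exact: ler_norm.
have n0 : (0 : R) < n%:R by rewrite ltr0n; lia.
rewrite ltr_pdivrMr // mulrC ltr_pdivlMr // -natrM ltr_nat; lia.
Unshelve. all: by end_near. Qed.

Lemma cvg_remaining : (fun n => (n - m n)%N) @ \oo --> \oo.
Proof.
move=> A [N _ NA]; rewrite /nbhs /=; near=> n; apply: NA => /=.
have : (2 * m n <= n)%N by near: n; exact: near_m_le_half.
have : (2 * N <= n)%N by near: n; exact: nbhs_infty_ge.
lia.
Unshelve. all: by end_near. Qed.

(** For fixed r, removing r cards from the deck does not change the limit of the
    mean. *)
Lemma cvg_moment_ratio c r :
  (fun n => moment_ratio R n (m n) (steps m c n) r) @ \oo --> expR (- c).
Proof.
apply: (@squeeze_cvgr _ _ _ _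
  (fun n => lam c n * ((1 - r%:R * n%:R^-1) * (1 - 4 * r%:R * ((ln n%:R + c) / n%:R))))
  (fun n => lam c n)); last exact: cvg_mean_untouched; last first.
  rewrite (_ : expR (- c) = expR (- c) * ((1 - r%:R * 0) * (1 - 4 * r%:R * 0))); last first.
    by rewrite !mulr0 !subr0 !mulr1.
  apply: cvgM; first exact: cvg_mean_untouched.
  apply: cvgM; (apply: cvgB; first exact: cvg_cst); apply: cvgMl_tmp.
    exact: cvg_inv_nat.
  exact: cvg_ln_div_nat.
near=> n.
have n2 : (2 <= n)%N by near: n; exact: nbhs_infty_ge.
have rn : (2 * r.+1 <= n)%N by near: n; exact: nbhs_infty_ge.
have mn : (2 * m n <= n)%N by near: n; exact: near_m_le_half.
have [rn' mn'] : (r < n)%N /\ (m n <= n)%N by split; lia.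
have /andP [st _] : (steps m c n)%:R * delta R m n <= ln n%:R + c <
   ((steps m c n)%:R + 1) * delta R m n by near: n; exact: near_steps.
rewrite moment_ratio_le // andbT; apply: moment_ratio_ge => //.
have n0 : (0 : R) < n%:R by rewrite ltr0n ltnW.
have /andP [d1 _] := delta_bounds n2; move: d1; rewrite ler_pdivrMr // => d1.
have := ler_wpM2l (ler0n R (steps m c n)) d1; have := ler_wpM2l (ltW n0) st.
rewrite [n%:R * (_ * _)]mulrC -mulrA => h1 h2; exact: le_trans h2 h1.
Unshelve. all: by end_near. Qed.

Lemma cvg_binomial_moment c r :
  (fun n => binomial_moment R n (m n) (steps m c n) r) @ \oo -->
  expR (- c) ^+ r / r`!%:R.
Proof.
elim: r => [|r IH].
  rewrite expr0 divr1; apply: cvg_near_cst; near=> n; apply: binomial_moment0.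
  have : (2 * m n <= n)%N by near: n; exact: near_m_le_half.
  lia.
rewrite factS natrM invfM exprSr.
rewrite (_ : _ * _ = expR (- c) ^+ r / r`!%:R * expR (- c) / r.+1%:R); last by ring.
apply: cvg_trans (cvgMr_tmp (cvgM IH (@cvg_moment_ratio c r))).
apply: near_eq_cvg; near=> n; rewrite binomial_momentS //.
by near: n; exact: nbhs_infty_gt.
Unshelve. all: by end_near. Qed.

Lemma series_expR (a : R) : series (fun s => a ^+ s / s`!%:R) @ \oo --> expR a.
Proof.
exact: is_cvg_series_exp_coeff.
Qed.

(** Method of moments: in the inclusion-exclusion formula the binomial moment of
    order r tends to l^r / r! and is dominated by K^r / r! for any K > l.  The limits
    sum to a multiple of the exponential series of - l. *)
Lemma cvg_untouched_prob c z :
  (fun n => untouched_prob R n (m n) (steps m c n) z) @ \oo -->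
  expR (- expR (- c)) * (expR (- c) ^+ z / z`!%:R).
Proof.
(* Any bound above l would do for K; the means are eventually below it. *)
set l := expR (- c); pose K := l + 1.
have K0 : 0 <= K by rewrite addr_ge0 // expR_ge0.
pose B s := K ^+ z / z`!%:R * (K ^+ s / s`!%:R).
pose F n s := (-1) ^+ s * 'C(z + s, z)%:R *
  binomial_moment R n (m n) (steps m c n) (z + s).
have fn0 s : s`!%:R != 0 :> R by rewrite pnatr_eq0 -lt0n fact_gt0.
have binE s : 'C(z + s, z)%:R = (z + s)`!%:R / (z`!%:R * s`!%:R) :> R.
  have /(congr1 (fun a => a%:R : R)) := bin_fact (leq_addr s z).
  by rewrite addKn !natrM => <-; rewrite mulfK // mulf_neq0.
pose G s := l ^+ z / z`!%:R * ((- l) ^+ s / s`!%:R).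
have FG s : F ^~ s @ \oo --> G s.
  rewrite (_ : G s = (-1) ^+ s * 'C(z + s, z)%:R * (l ^+ (z + s) / (z + s)`!%:R)).
    by apply: cvgMl_tmp; exact: cvg_binomial_moment.
  by rewrite binE /G exprD -(mulN1r l) exprMn; field; rewrite !fn0.
have seriesZ (a : R) (h : nat -> R) (S : R) : series h @ \oo --> S ->
    series (fun s => a * h s) @ \oo --> a * S.
  move=> hS; rewrite (_ : series _ = fun n => a * series h n).
    by apply: cvgMl_tmp.
  by apply/funext => n; rewrite /series /= mulr_sumr.
have := @tannery R F G B (fun n => (n - z).+1) (expR (- l) * (l ^+ z / z`!%:R)).
move=> T; apply: cvg_trans (T _ _ _ _ _) => {T}.
- apply: near_eq_cvg; near=> n; rewrite untouched_probE //.
  by near: n; exact: nbhs_infty_ge.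
- apply: (cvgP (K ^+ z / z`!%:R * expR K)); apply: seriesZ; exact: series_expR.
- near=> n.
  have lamK : lam c n <= K.
    by near: n; apply: (cvgr_le l) => //; rewrite ?ltrDl //; exact: cvg_mean_untouched.
  have mn : (m n <= n)%N.
    have : (2 * m n <= n)%N by near: n; exact: near_m_le_half.
    lia.
  have lam0 : 0 <= lam c n.
    rewrite mulr_ge0 // exprn_ge0 // subr_ge0.
    have [->|n0] := posnP n; first by rewrite invr0 mulr0.
    by rewrite ler_pdivrMr ?ltr0n // mul1r ler_nat.
  move=> s; rewrite /F -mulrA normrM normrX normrN1 expr1n mul1r.
  rewrite ger0_norm ?mulr_ge0 ?binomial_moment_ge0 //.
  apply: (@le_trans _ _ ('C(z + s, z)%:R * (K ^+ (z + s) / (z + s)`!%:R))).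
    apply: ler_wpM2l => //.
    apply: le_trans (@binomial_moment_le R n (m n) (steps m c n) mn (z + s)) _.
    by rewrite ler_wpM2r ?invr_ge0 // lerXn2r // nnegrE.
  rewrite binE /B exprD le_eqVlt; apply/orP; left; apply/eqP.
  by field; rewrite !fn0.
- exact: FG.
- move=> A [M _ MA]; rewrite /nbhs /=; near=> n; apply: MA => /=.
  have : (M + z <= n)%N by near: n; exact: nbhs_infty_ge.
  lia.
- by rewrite mulrC; apply: seriesZ; exact: series_expR.
Unshelve. all: by end_near. Qed.

End PoissonLimit.

(** * The limit profile *)

Section Profile.
Variables (R : realType) (p : nat).
Hypothesis p_gt0 : (0 < p)%N.
Local Notation a := (a_coef R p).
Local Notation b := (tail_prob R p).

Lemma tail_prob0 : b 0 = 1.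
Proof. by rewrite /tail_prob fact0 expn0 invr1. Qed.

Lemma tail_prob_le_inv M : (0 < M)%N -> b M <= M%:R^-1.
Proof.
move=> M0; rewrite lef_pV2 ?posrE ?ltr0n ?muln_gt0 ?fact_gt0 ?expn_gt0 ?p_gt0 //.
rewrite ler_nat -{1}[M]muln1 leq_mul ?expn_gt0 ?p_gt0 //.
by apply: dvdn_leq; rewrite ?fact_gt0 // dvdn_fact // M0 leqnn.
Qed.

(** This is u! N p^u <= N! p^N, and yields the bound of order 1 / N for the boundary
    term of [sum_a_s_coef]. *)
Lemma tail_prob_expn_le u N : (u < N)%N ->
  p%:R ^+ u * b N <= u`!%:R^-1 * N%:R^-1.
Proof.
case: N => // N; rewrite ltnS => uN; have pX j : (0 < p ^ j)%N by rewrite expn_gt0 p_gt0.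
rewrite -invfM -natrX -natrM ler_pdivrMr ?ltr0n ?muln_gt0 ?fact_gt0 ?pX //.
rewrite ler_pdivlMl ?ltr0n ?muln_gt0 ?fact_gt0 // -natrM ler_nat factS.
rewrite -(subnKC uN) -addnS expnD.
have fB : (u`! <= (u + (N - u))`! * p ^ (N - u).+1)%N.
  by apply: leq_trans (leq_pmulr _ (pX _)); apply: leq_fact; rewrite leq_addr.
have E c d e f : (c * d * (e * f) = d * f * c * e)%N by ring.
by rewrite E !leq_mul.
Qed.

Lemma cvg_tail_prob : b @ \oo --> (0 : R).
Proof.
apply: (@squeeze_cvgr _ _ _ _ (fun=> 0) (fun n => n%:R^-1)); last exact: cvg_inv_nat.
  by near=> n; rewrite tail_prob_ge0 tail_prob_le_inv //; near: n; exact: nbhs_infty_gt.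
exact: cvg_cst.
Unshelve. all: by end_near. Qed.

Lemma sum_a_coef M N : (M <= N)%N -> \sum_(M <= l < N) a l = b M - b N.
Proof.
move=> MN; rewrite (eq_bigr (fun l => - (b l.+1 - b l))) => [|l _]; last by rewrite opprB.
by rewrite sumrN telescope_sumr // opprB.
Qed.

Variable lam : R.
Hypothesis lam_ge0 : 0 <= lam.
Local Notation s l := (s_coef p l lam).

Lemma s_coef_ge l : expR (- lam) <= s l.
Proof.
rewrite /s_coef ler_peMr ?expR_ge0 // big_nat_recl //= expr0 lerDl.
by apply: sumr_ge0 => i _; rewrite exprn_ge0 // mulr_ge0.
Qed.

(** Summation by parts, with a_l = b_l - b_(l+1): the increment of s_l, multiplied by
    b_l, is exp (- lam) lam^l / l!. *)
Lemma sum_a_s_coef N : \sum_(0 <= l < N) a l * s l =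
  expR (- lam) * (\sum_(0 <= l < N) lam ^+ l / l`!%:R
                  - b N * \sum_(0 <= u < N) (p%:R * lam) ^+ u).
Proof.
elim: N => [|N IH]; first by rewrite !big_geq // mulr0 subr0 mulr0.
rewrite big_nat_recr //= IH /s_coef [in RHS]big_nat_recr //= !(big_nat_recr N 0) //=.
have -> : lam ^+ N / N`!%:R = b N * (p%:R * lam) ^+ N.
  rewrite /tail_prob exprMn natrM natrX; field.
  by rewrite expf_neq0 ?pnatr_eq0 -?lt0n ?fact_gt0.
rewrite -[a N]/(b N - b N.+1); ring.
Qed.

Lemma sum_a_s_coef_le N : \sum_(0 <= l < N) a l * s l <=
  expR (- lam) * \sum_(0 <= l < N) lam ^+ l / l`!%:R.
Proof.
rewrite sum_a_s_coef ler_wpM2l ?expR_ge0 // gerBl mulr_ge0 ?tail_prob_ge0 //.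
by apply: sumr_ge0 => i _; rewrite exprn_ge0 // mulr_ge0.
Qed.

Lemma partial_exp_le N : \sum_(0 <= l < N) lam ^+ l / l`!%:R <= expR lam.
Proof.
apply: (@nondecreasing_cvgn_le _ (series (exp_coeff lam))).
  move=> i j ij; rewrite -subr_ge0 sub_series_geq // sumr_ge0 // => k _.
  exact: exp_coeff_ge0.
exact: is_cvg_series_exp_coeff.
Qed.

(** The limit density s has total mass 1 with respect to the weights a, since the
    exponential series sums to exp lam. *)
Lemma cvg_sum_a_s_coef : (fun N => \sum_(0 <= l < N) a l * s l) @ \oo --> (1 : R).
Proof.
rewrite (_ : (1 : R) = expR (- lam) * (expR lam - 0)); last first.
  by rewrite subr0 -expRD addNr expR0.
under eq_fun do rewrite sum_a_s_coef.
apply: cvgMl_tmp; apply: cvgB; first exact: series_expR.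
apply: (@squeeze_cvgr _ _ _ _ (fun=> 0) (fun N => expR lam * N%:R^-1)); last first.
- by rewrite -[X in _ --> X](mulr0 (expR lam)); apply: cvgMl_tmp; exact: cvg_inv_nat.
- exact: cvg_cst.
near=> N; have N0 : (0 < N)%N by near: N; exact: nbhs_infty_gt.
apply/andP; split.
  rewrite mulr_ge0 ?tail_prob_ge0 //.
  by apply: sumr_ge0 => i _; rewrite exprn_ge0 // mulr_ge0.
apply: (@le_trans _ _ ((\sum_(0 <= l < N) lam ^+ l / l`!%:R) * N%:R^-1)); last first.
  by rewrite ler_wpM2r ?invr_ge0 // partial_exp_le.
rewrite mulr_sumr mulr_suml !big_mkord; apply: ler_sum => u _.
rewrite exprMn (_ : b N * _ = lam ^+ u * (p%:R ^+ u * b N)); last by ring.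
by rewrite -[leRHS]mulrA ler_wpM2l ?exprn_ge0 // tail_prob_expn_le.
Unshelve. all: by end_near. Qed.

Local Notation pos_part l := (a l * Num.max (1 - s l) 0).

Lemma pos_part_bounds l : 0 <= pos_part l <= a l.
Proof.
rewrite mulr_ge0 ?a_coef_ge0 //=; last by rewrite le_max lexx orbT.
rewrite ler_piMr ?a_coef_ge0 // ge_max ler01 andbT gerBl.
exact: le_trans (expR_ge0 _) (s_coef_ge l).
Qed.

Lemma sum_pos_part_le M N : (M <= N)%N ->
  0 <= \sum_(M <= l < N) pos_part l <= b M.
Proof.
move=> MN; apply/andP; split.
  by apply: sumr_ge0 => l _; case/andP: (pos_part_bounds l).
apply: (@le_trans _ _ (\sum_(M <= l < N) a l)).
  by apply: ler_sum => l _; case/andP: (pos_part_bounds l).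
by rewrite sum_a_coef // gerBl tail_prob_ge0.
Qed.

(** The positive parts of s - 1 and of 1 - s have the same weighted sum, because the
    weights a and the products a s both sum to 1.  The second is bounded by 1. *)
Lemma cvg_pos_part : series (fun l => pos_part l) @ \oo -->
  limn (series (fun l => a l * Num.max (s l - 1) 0)).
Proof.
have cvgA : (fun N => \sum_(0 <= l < N) a l) @ \oo --> (1 : R).
  rewrite (_ : (fun N => _) = fun N => 1 - b N); last first.
    by apply/funext => N; rewrite sum_a_coef // tail_prob0.
  rewrite -[X in _ --> X](subr0 1); apply: cvgB; first exact: cvg_cst.
  exact: cvg_tail_prob.
have cvgS : cvgn (series (fun l => pos_part l)).
  apply: (@series_le_cvg _ _ a) => [l|l|l|]; rewrite ?a_coef_ge0 //.
  - by case/andP: (pos_part_bounds l).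
  - by case/andP: (pos_part_bounds l).
  - by apply: (cvgP (1 : R)); exact: cvgA.
have E : series (fun l => a l * Num.max (s l - 1) 0) = fun N =>
  series (fun l => pos_part l) N
   + (\sum_(0 <= l < N) a l * s l - \sum_(0 <= l < N) a l).
  apply/funext => N; rewrite /series /= -sumrB -big_split /=; apply: eq_bigr => l _.
  have -> : Num.max (s l - 1) 0 = Num.max (1 - s l) 0 + (s l - 1).
    by case: (ler0P (1 - s l)); case: (ler0P (s l - 1)); lra.
  by ring.
rewrite E; suff -> : limn (fun N => series (fun l => pos_part l) N
   + (\sum_(0 <= l < N) a l * s l - \sum_(0 <= l < N) a l)) =
   limn (series (fun l => pos_part l)) by exact: cvgS.
apply/cvg_lim => //.
suff : (fun N => series (fun l => pos_part l) N
   + (\sum_(0 <= l < N) a l * s l - \sum_(0 <= l < N) a l)) @ \oo -->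
   limn (series (fun l => pos_part l)) + (1 - 1) by rewrite subrr addr0.
by apply: cvgD => //; apply: cvgB => //; exact: cvg_sum_a_s_coef.
Qed.

Lemma pos_part_approx M :
  `|\sum_(l < M) pos_part l
    - limn (series (fun l => a l * Num.max (s l - 1) 0))| <= b M.
Proof.
rewrite -(big_mkord xpredT (fun l => pos_part l)) distrC.
apply: (@cvgr_to_le _ \oo _ _ (fun N => `|series (fun l => pos_part l) N
   - \sum_(0 <= l < M) pos_part l|)).
  by apply: cvg_norm; apply: cvgB; [exact: cvg_pos_part | exact: cvg_cst].
near=> N; have MN : (M <= N)%N by near: N; exact: nbhs_infty_ge.
have /andP [h0 h1] := sum_pos_part_le MN.
by rewrite -[X in _ - X]/(series _ M) sub_series_geq // ger0_norm.
Unshelve. all: by end_near. Qed.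

End Profile.

Section ProfileAtInfinity.
Variables (R : realType) (p : nat).
Hypothesis p_gt0 : (0 < p)%N.
Local Notation a := (a_coef R p).
Local Notation b := (tail_prob R p).

Lemma tv_profile_ge0 c : 0 <= tv_profile p c :> R.
Proof.
apply: (@cvgr_to_ge _ \oo _ _ _ _ _ (cvg_pos_part p_gt0 (expR_ge0 (- c)))).
near=> N; have := sum_pos_part_le p_gt0 (expR_ge0 (- c)) (leq0n N).
by case/andP.
Unshelve. all: by end_near. Qed.

(** Every s_l is at least its term for u = 0, exp (- lam) >= 1 - lam. *)
Lemma tv_profile_le_exp c : tv_profile p c <= expR (- c) :> R.
Proof.
set lam := expR (- c).
apply: (@cvgr_to_le _ \oo _ _ _ _ _ (cvg_pos_part p_gt0 (expR_ge0 (- c)))).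
near=> N; rewrite /series /=.
apply: (@le_trans _ _ (\sum_(0 <= l < N) a l * (1 - expR (- lam)))).
  apply: ler_sum => l _; rewrite ler_wpM2l ?a_coef_ge0 // ge_max.
  rewrite lerB ?s_coef_ge ?expR_ge0 //= subr_ge0 expR_le1 oppr_le0.
  exact: expR_ge0.
have e1 : 0 <= 1 - expR (- lam) by rewrite subr_ge0 expR_le1 oppr_le0 expR_ge0.
rewrite -mulr_suml; apply: (@le_trans _ _ (1 * (1 - expR (- lam)))).
  rewrite ler_wpM2r // sum_a_coef // tail_prob0 gerBl; exact: tail_prob_ge0.
have := expR_ge1Dx (- lam); lra.
Unshelve. all: by end_near. Qed.

Lemma cvg_tv_profile_pinfty : (fun c : R => tv_profile p c) @ +oo --> (0 : R).
Proof.
apply: (@squeeze_cvgr _ _ _ _ (fun=> 0) (fun c => expR (- c))); last exact: cvgr_expR.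
  by apply: nearW => c; rewrite tv_profile_ge0 tv_profile_le_exp.
exact: cvg_cst.
Qed.

(** This is the bound exp lam >= lam^(l+1) / (l+1)! in another form. *)
Lemma expR_mul_pow_le (lam : R) l : 0 < lam ->
  expR (- lam) * (lam ^+ l / l`!%:R) <= l.+1%:R / lam.
Proof.
move=> l0; have := expR_ge1Dxn l (ltW l0) => h.
have {}h : lam ^+ l.+1 / l.+1`!%:R <= expR lam by lra.
rewrite ler_pdivlMr // expRN -mulrA ler_pdivrMl ?expR_gt0 //.
apply: le_trans (ler_wpM2r (ler0n R l.+1) h).
rewrite exprSr factS natrM le_eqVlt; apply/orP; left; apply/eqP.
by field; rewrite nat1r !pnatr_eq0 -!lt0n fact_gt0.
Qed.

(** Up to b_M the profile is the sum of a_l (1 - s_l) for l < M; here the a_l sum to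
    1 - b_M and the a_l s_l at most to the probability that a Poisson variable of
    parameter lam is below M. *)
Lemma tv_profile_ge c M : c < 0 ->
  1 - 2 * b M - M%:R * M%:R / (- c) <= tv_profile p c :> R.
Proof.
move=> c0; set lam := expR (- c); have lam0 : 0 < lam := expR_gt0 _.
have := pos_part_approx p_gt0 (expR_ge0 (- c)) M; rewrite -/(tv_profile p c) -/lam.
rewrite ler_norml => /andP [_ h].
have h1 : \sum_(l < M) a l - \sum_(l < M) a l * s_coef p l lam <=
   \sum_(l < M) a l * Num.max (1 - s_coef p l lam) 0.
  rewrite -sumrB; apply: ler_sum => l _.
  by rewrite -{1}[a l]mulr1 -mulrBr ler_wpM2l ?a_coef_ge0 // le_max lexx.
have h2 : \sum_(l < M) a l * s_coef p l lam <= M%:R * M%:R / (- c).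
  rewrite -(big_mkord xpredT (fun l => a l * s_coef p l lam)).
  apply: le_trans (sum_a_s_coef_le p_gt0 (expR_ge0 _) M) _.
  rewrite mulr_sumr big_mkord; apply: (@le_trans _ _ (\sum_(l < M) M%:R / (- c))).
    apply: ler_sum => l _; apply: le_trans (expR_mul_pow_le _ lam0) _.
    rewrite ler_pM ?invr_ge0 ?ler_nat // ?(ltW lam0) //.
    rewrite lef_pV2 ?posrE // ?oppr_gt0 //.
    have := expR_ge1Dx (- c); rewrite -/lam; lra.
  by rewrite sumr_const card_ord -[_ *+ M]mulr_natl mulrA lexx.
have h3 : \sum_(l < M) a l = 1 - b M.
  by rewrite -(big_mkord xpredT a) sum_a_coef // tail_prob0.
lra.
Qed.

Lemma tv_profile_le1 c : tv_profile p c <= 1 :> R.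
Proof.
apply: (@cvgr_to_le _ \oo _ _ _ _ _ (cvg_pos_part p_gt0 (expR_ge0 (- c)))).
near=> N; have := sum_pos_part_le p_gt0 (expR_ge0 (- c)) (leq0n N).
by rewrite tail_prob0; case/andP.
Unshelve. all: by end_near. Qed.

Lemma cvg_tv_profile_ninfty : (fun c : R => tv_profile p c) @ -oo --> (1 : R).
Proof.
apply/cvgrPdist_le => e e0.
(* The error 2 b_M + M^2 / (- c) is split as e / 2 + e / 2: b_M < e / 4 by the choice
   of M, and c is negative enough for the second term. *)
have e4 : 0 < e / 4 by rewrite divr_gt0.
have /cvgrPdist_lt /(_ _ e4) [M _ /(_ M.+1 (leqnSn M))] := @cvg_tail_prob R _ p_gt0.
rewrite sub0r normrN ger0_norm ?tail_prob_ge0 // => bM.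
near=> c.
have c0 : c < 0 by near: c; apply: nbhs_ninfty_lt; exact: num_real.
have cM : c <= - (M.+1%:R * M.+1%:R / (e / 2)).
  by near: c; apply: nbhs_ninfty_le; exact: num_real.
rewrite ger0_norm ?subr_ge0 ?tv_profile_le1 //.
have := @tv_profile_ge c M.+1 c0.
have : M.+1%:R * M.+1%:R / (- c) <= e / 2.
  by rewrite ler_pdivrMr ?oppr_gt0 // [leRHS]mulrC -ler_pdivrMr ?divr_gt0 // lerNr.
lra.
Unshelve. all: by end_near. Qed.

End ProfileAtInfinity.

(** * Convergence of the distances, and the cutoff *)

Section Cutoff.
Variables (R : realType) (m : nat -> nat).
Hypothesis m_bounds : forall n : nat, (2 <= n)%N -> (1 <= m n <= n - 1)%N.
Hypothesis m_small : (fun n : nat => (m n)%:R / n%:R : R) @ \oo --> (0 : R).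
Variable p : nat.
Hypothesis p_gt0 : (0 < p)%N.

Lemma cvg_density c l :
  (fun n => density R n (m n) (steps m c n) p l) @ \oo --> s_coef p l (expR (- c)).
Proof.
rewrite /s_coef big_mkord mulr_sumr; apply: cvg_big => [|u _]; first exact: add_continuous.
rewrite (_ : expR _ * _ =
  (u`! * p ^ u)%:R * (expR (- expR (- c)) * (expR (- c) ^+ u / u`!%:R))).
  by apply: cvgMl_tmp; exact: cvg_untouched_prob.
rewrite exprMn natrM natrX; field.
by rewrite pnatr_eq0 -lt0n fact_gt0.
Qed.

Lemma shuffle_tv_truncation n k M : (2 <= n)%N -> (M <= n)%N ->
  `|shuffle_tv R m p n k
    - \sum_(l < M) a_coef R p l * Num.max (1 - density R n (m n) k p l) 0|
  <= tail_prob R p M.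
Proof.
move=> n2; have mn : (m n <= n)%N by have := m_bounds n2; lia.
by case: n n2 mn => // n' _ mn Mn; exact: shuffle_tv_approx.
Qed.

Lemma shuffle_sepE n k : (2 <= n)%N ->
  shuffle_sep R m p n k = 1 - density R n (m n) k p (p == 1%N).
Proof.
move=> n2; have mn : (m n <= n)%N by have := m_bounds n2; lia.
case: n n2 mn => // n' n2 mn; case: eqP => p1; first exact: shuffle_sep_one_color.
by apply: shuffle_sep_many_colors => //; lia.
Qed.

Lemma cvg_shuffle_tv c :
  (fun n => shuffle_tv R m p n (steps m c n)) @ \oo --> tv_profile p c.
Proof.
apply: (@cvg_truncation R (fun n => shuffle_tv R m p n (steps m c n)) (tv_profile p c)
  (fun M n => \sum_(l < M) a_coef R p l *
     Num.max (1 - density R n (m n) (steps m c n) p l) 0)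
  (fun M => \sum_(l < M) a_coef R p l * Num.max (1 - s_coef p l (expR (- c))) 0)
  (tail_prob R p)) => [|M|M|M].
- exact: cvg_tail_prob.
- near=> n; have n2 : (2 <= n)%N by near: n; exact: nbhs_infty_ge.
  by apply: shuffle_tv_truncation => //; near: n; exact: nbhs_infty_ge.
- apply: cvg_big => [|l _]; first exact: add_continuous.
  apply: cvgMl_tmp.
  under eq_fun do rewrite maxr_absE. rewrite maxr_absE.
  apply: cvgMr_tmp; apply: cvgD.
    apply: cvgD; last exact: cvg_cst.
    by apply: cvgB; [exact: cvg_cst | exact: cvg_density].
  apply: cvg_norm; apply: cvgB; last exact: cvg_cst.
  by apply: cvgB; [exact: cvg_cst | exact: cvg_density].
- exact: pos_part_approx.
Unshelve. all: by end_near. Qed.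

Lemma cvg_shuffle_sep c :
  (fun n => shuffle_sep R m p n (steps m c n)) @ \oo -->
    (if p == 1%N then 1 - expR (- expR (- c)) * (1 + expR (- c))
     else 1 - expR (- expR (- c))).
Proof.
case: eqP => [p1|p1].
  rewrite (_ : expR _ * _ = s_coef p 1 (expR (- c))); last first.
    by rewrite /s_coef p1 !big_nat_recl // big_geq //= expr0 expr1 mul1r addr0.
  apply: cvg_trans (cvgB (cvg_cst (1 : R)) (@cvg_density c 1)).
  apply: near_eq_cvg; near=> n.
  by rewrite shuffle_sepE ?p1 //; near: n; exact: nbhs_infty_ge.
rewrite (_ : expR (- expR (- c)) = s_coef p 0 (expR (- c))); last first.
  by rewrite /s_coef big_nat1 expr0 mulr1.
apply: cvg_trans (cvgB (cvg_cst (1 : R)) (@cvg_density c 0)).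
apply: near_eq_cvg; near=> n.
rewrite shuffle_sepE; last by near: n; exact: nbhs_infty_ge.
by rewrite (negPf (introN eqP p1)).
Unshelve. all: by end_near. Qed.

Lemma shuffle_tv_cutoff : tv_cutoff (shuffle_tv R m p)
  (fun n : nat => ln n%:R / delta R m n) (fun n : nat => (delta R m n)^-1).
Proof.
have E c : (fun n => (shuffle_tv R m p n
      (Num.truncn (ln n%:R / delta R m n + c * (delta R m n)^-1)))%:E) @ \oo
    --> (tv_profile p c)%:E.
  apply: cvg_EFin; first exact: nearW.
  rewrite /comp /=; under eq_fun do rewrite -mulrDl.
  exact: cvg_shuffle_tv.
split.
- apply: cvg_trans (@cvg_invr_ln_nat R); apply: near_eq_cvg; near=> n.
  have n2 : (2 <= n)%N by near: n; exact: nbhs_infty_ge.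
  have d0 := delta_gt0 R m_bounds n2.
  by rewrite invfM invrK mulrCA mulVf ?gt_eqF // mulr1.
- rewrite (_ : (fun c => _) = fun c => (tv_profile p c)%:E); last first.
    by apply/funext => c; rewrite (cvg_limn_einf_sup (E c)).1.
  apply: cvg_EFin; [exact: nearW | exact: cvg_tv_profile_ninfty].
- rewrite (_ : (fun c => _) = fun c => (tv_profile p c)%:E); last first.
    by apply/funext => c; rewrite (cvg_limn_einf_sup (E c)).2.
  apply: cvg_EFin; [exact: nearW | exact: cvg_tv_profile_pinfty].
Unshelve. all: by end_near. Qed.

End Cutoff.

Theorem corollary5p1 (R : realType) (m : nat -> nat)
  (m_bounds : forall n : nat, (2 <= n)%N -> (1 <= m n <= n - 1)%N)
  (m_small : (fun n : nat => (m n)%:R / n%:R : R) @ \oo --> (0 : R)) :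
  [/\ (forall c : R,
         (fun n : nat => n%:R * (1 - (m n)%:R / n%:R) ^+ steps m c n : R) @ \oo
           --> expR (- c)),
      (fun n : nat => (n - m n)%N) @ \oo --> \oo,
      (forall p : nat, (1 <= p)%N ->
         [/\ (forall c : R,
                (fun n : nat => shuffle_tv R m p n (steps m c n)) @ \oo
                  --> tv_profile p c),
             (forall c : R,
                (fun n : nat => shuffle_sep R m p n (steps m c n)) @ \oo
                  --> (if p == 1%N
                       then 1 - expR (- expR (- c)) * (1 + expR (- c))
                       else 1 - expR (- expR (- c)))) &
             tv_cutoff (shuffle_tv R m p)
               (fun n : nat => ln n%:R / delta R m n)
               (fun n : nat => (delta R m n)^-1)]),
      asymp_equiv (fun n : nat => ln n%:R / delta R m n)
                  (fun n : nat => n%:R / (m n)%:R * ln n%:R) &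
      asymp_equiv (fun n : nat => (delta R m n)^-1)
                  (fun n : nat => n%:R / (m n)%:R)].
Proof.
have ratio : (fun n => (m n)%:R / n%:R / delta R m n) @ \oo --> (1 : R).
  exact: cvg_frac_div_delta.
split.
- by move=> c; exact: cvg_mean_untouched.
- exact: cvg_remaining m_small.
- move=> p p1; split=> [c|c|].
  + exact: cvg_shuffle_tv.
  + exact: cvg_shuffle_sep.
  + exact: shuffle_tv_cutoff.
- apply: cvg_trans ratio; apply: near_eq_cvg; near=> n.
  have n2 : (2 <= n)%N by near: n; exact: nbhs_infty_ge.
  have l0 : ln n%:R != 0 :> R by rewrite gt_eqF // ln_gt0 // ltr1n.
  have -> : ln n%:R / delta R m n / (n%:R / (m n)%:R * ln n%:R)
          = (n%:R / (m n)%:R)^-1 / delta R m n * (ln n%:R / ln n%:R).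
    by rewrite invfM; ring.
  by rewrite divff // mulr1 invfM invrK [_^-1 * (m n)%:R]mulrC.
- apply: cvg_trans ratio; apply: near_eq_cvg; near=> n.
  by rewrite invfM invrK mulrC [_^-1 * (m n)%:R]mulrC.
Unshelve. all: by end_near. Qed.
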